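(* Let $m>2$, let $[\xi^{A'}]$ be a holomorphic projective pure spinor field on a $2m$-dimensional spin complex Riemannian manifold $(\mathcal M,g)$, and let $\Gamma_{abc}\xi^{bB}\xi^{cC}\in\mathfrak W$ be its associated intrinsic torsion. Then, pointwise, - ${}^{\mathfrak W}_\xi\Pi^0_{-\frac32}(\Gamma)=0$ if and only if $(\xi^{a[A}\nabla_a\xi^{bB})\xi_b{}^{C]}=0$; - ${}^{\mathfrak W}_\xi\Pi^1_{-\frac32}(\Gamma)=0$ if and only if $(\xi^{a(A}\nabla_a\xi^{bB)})\xi_b{}^{C}=0$; - ${}^{\mathfrak W}_\xi\Pi^0_{-\frac12}(\Gamma)=0$ if and only if $\xi^{A'}\nabla_b\xi^{bB}-\xi^{bB}\nabla_b\xi^{A'}=0$; - ${}^{\mathfrak W}_\xi\Pi^1_{-\frac12}(\Gamma)=0$ if and only if $$(\nabla_a\xi^{bB})\xi_b{}^{C}+\tfrac2{m-1}\big(\xi_a{}^{[B}\nabla_b\xi^{bC]}+\xi^{b[B}\nabla_b\xi_a{}^{C]}\big)=0\qquad(m>3),$$ $$(\nabla_a\xi^{bB})\xi_b{}^{C}+\big(\xi_a{}^{[B}\nabla_b\xi^{bC]}+\xi^{b[B}\nabla_b\xi_a{}^{C]}\big)-\tfrac23\,\xi^{bA}(\nabla_b\xi_A)\gamma_a{}^{BC}=0\qquad(m=3).$$ All of these statements are independent of the scaling of $\xi^{A'}$.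
   Context: $(\mathcal M,g)$ is a complex manifold of dimension $n=2m$ with a non-degenerate holomorphic section $g_{ab}$ of $\odot^2T^*\mathcal M$ (holomorphic metric), a holomorphic volume form and a holomorphic spin structure; $\nabla_a$ is its holomorphic Levi-Civita connection and the induced spin connection. All fields are holomorphic. $\mathcal S^\pm$ are the chiral spinor bundles; sections of $\mathcal S^+$ have primed upper indices and of $\mathcal S^-$ unprimed ones. Clifford multiplication is given by ($\nabla$-parallel) $\gamma_{aA'}{}^B$, $\gamma_{aA}{}^{B'}$ with $\gamma_{(a|A'}{}^{C}\gamma_{|b)C}{}^{B'}=-g_{ab}\delta_{A'}^{B'}$, $\gamma_{(a|A}{}^{C'}\gamma_{|b)C'}{}^{B}=-g_{ab}\delta_A^B$; $\gamma_{abA'}{}^{B'}:=\gamma_{[a|A'}{}^{C}\gamma_{|b]C}{}^{B'}$. Brackets denote normalised (skew-)symmetrisation. For $\xi^{A'}$ put $\xi_a{}^A:=\xi^{B'}\gamma_{aB'}{}^A$, $\xi_{ab}{}^{A'}:=\xi^{B'}\gamma_{abB'}{}^{A'}$. $\xi^{A'}$ is pure if it is nowhere zero and at every point the kernel of $\xi_a{}^A:T\mathcal M\to\mathcal S^-$ has dimension $m$; a projective pure spinor field $[\xi^{A'}]$ is a pure spinor field up to scale. At a point let $\mathfrak V$ be the tangent space, $\mathfrak g=\mathfrak{so}(2m,\mathbb C)\cong\wedge^2\mathfrak V^*$, $\mathfrak p=\{\phi_{ab}\in\mathfrak g:\xi^{aA}\xi^{bB}\phi_{ab}=0\}$ the stabiliser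 of $[\xi^{A'}]$, and $\mathfrak W:=\mathfrak V\otimes(\mathfrak g/\mathfrak p)$, whose elements are written $\Gamma_{abc}\xi^{bB}\xi^{cC}$ with $\Gamma_{abc}=\Gamma_{a[bc]}\in\mathfrak V\otimes\mathfrak g$ (determined modulo $\mathfrak V\otimes\mathfrak p$). The intrinsic torsion of $[\xi^{A'}]$ is the element $\Gamma_{abc}\xi^{bB}\xi^{cC}=(\nabla_a\xi^{bB})\xi_b{}^{C}$ of $\mathfrak W$; equivalently $\Gamma_{abc}$ is such that $\nabla_a\xi^{A'}=-\frac14\Gamma_{abc}\gamma^{bc}{}_{B'}{}^{A'}\xi^{B'}$ modulo terms of the form $\alpha_a\xi^{A'}$. The maps are $${}^{\mathfrak W}_\xi\Pi^0_{-\frac32}(\Gamma):=\Gamma_{abc}\xi^{a[A}\xi^{bB}\xi^{cC]},\quad {}^{\mathfrak W}_\xi\Pi^1_{-\frac32}(\Gamma):=\Gamma_{abc}\xi^{a(A}\xi^{bB)}\xi^{cC},$$ $${}^{\mathfrak W}_\xi\Pi^0_{-\frac12}(\Gamma):=\xi^{A'}\Gamma_{bcd}\xi^{cdD'}\gamma^b{}_{D'}{}^B-\xi^{bB}\Gamma_{bcd}\xi^{cdA'},$$ $${}^{\mathfrak W}_\xi\Pi^1_{-\frac12}(\Gamma):=\Gamma_{abc}\xi^{bB}\xi^{cC}-\tfrac1{2(m-1)}\big(\xi_a{}^{[B|}\Gamma_{bcd}\xi^{cdD'}\gamma^b{}_{D'}{}^{|C]}+\xi^{b[B|}\Gamma_{bcd}\xi^{cdD'}\gamma_{aD'}{}^{|C]}\big)\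 (m>3),$$ $${}^{\mathfrak W}_\xi\Pi^1_{-\frac12}(\Gamma):=\Gamma_{abc}\xi^{bB}\xi^{cC}-\tfrac14\big(\xi_a{}^{[B|}\Gamma_{bcd}\xi^{cd}{}_D\gamma^{bD|C]}+\xi^{b[B|}\Gamma_{bcd}\xi^{cd}{}_D\gamma_a{}^{D|C]}\big)+\tfrac16\xi^{bA}\Gamma_{bcd}\xi^{cd}{}_A\gamma_a{}^{BC}\ (m=3).$$ For $m=3$ the isomorphism $\mathcal S^+\cong(\mathcal S^-)^*$ is used to replace upper primed indices by lower unprimed ones: $\xi^{A'}$ becomes $\xi_A$, $\gamma_{aA'}{}^B$ becomes the skew $\gamma_a{}^{AB}$, $\gamma_{aA}{}^{B'}$ becomes the skew $\gamma_{aAB}$, $\xi_a{}^B=\xi_A\gamma_a{}^{AB}$, $\xi_{abD}=\xi_E\gamma_{[a}{}^{EF}\gamma_{b]FD}$. *)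

(* Defs.v *)
From HB Require Import structures.
From mathcomp Require Import all_boot all_order all_algebra.
From mathcomp Require Import complex.
From mathcomp Require Import all_classical all_reals all_analysis.
From mathcomp Require Import ring.
Export Order.TTheory GRing.Theory Num.Theory numFieldNormedType.Exports.

Set Implicit Arguments.
Unset Strict Implicit.
Unset Printing Implicit Defensive.

Local Open Scope classical_set_scope.
Local Open Scope ring_scope.

(* R[i], viewed through its structure so that the normed-module structures of  *)
(* MathComp-Analysis on number fields and on their matrices are inferred.      *)
(* Over this field [differentiable] is complex (Frechet) differentiability.    *)
Definition Cx (R : realType) : numClosedFieldType := R[i].

(* An atlas; [coordV i] is only meaningful on the image of [coord i].          *)
Record complex_manifold (R : realType) (n : nat) := ComplexManifold {
  mpoint :> topologicalType;
  chart : Type;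
  dom : chart -> set mpoint;
  coord : chart -> mpoint -> 'rV[Cx R]_n;
  coordV : chart -> 'rV[Cx R]_n -> mpoint;
  man_hausdorff : hausdorff_space mpoint;
  man_second_countable : @second_countable mpoint;
  dom_open : forall i, open (dom i);
  dom_cover : forall p, exists i, dom i p;
  coord_open : forall i, open (coord i @` dom i);
  coordK : forall i p, dom i p -> coordV i (coord i p) = p;
  coord_continuous : forall i p, dom i p -> {for p, continuous (coord i)};
  coordV_continuous :
    forall i p, dom i p -> {for coord i p, continuous (coordV i)};
  transition_holomorphic : forall i j p, dom i p -> dom j p ->
    differentiable (coord j \o coordV i) (coord i p) }.

Section Manifold.
Context {R : realType} {n : nat} (M : complex_manifold R n).

Definition holomorphic_on (i : chart M) (U : set M)
    (W : normedModType (Cx R)) (f : M -> W) : Prop :=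
  forall p, U p -> differentiable (f \o coordV i) (coord i p).

(* Vectors are rows: v *m jac i j p is v transported from chart i to chart j.  *)
Definition jac (i j : chart M) (p : M) : 'M[Cx R]_n :=
  jacobian (coord j \o coordV i) (coord i p).

(* [metric i] is the matrix of g in chart i, and [vol i] is the coefficient of *)
(* the volume form on dz^1 /\ ... /\ dz^n, normalised by g.                    *)
Record holomorphic_metric := HolomorphicMetric {
  metric : chart M -> M -> 'M[Cx R]_n;
  vol : chart M -> M -> Cx R;
  metric_holomorphic : forall i, holomorphic_on i (dom i) (metric i);
  metric_sym : forall i p, dom i p -> (metric i p)^T = metric i p;
  metric_nondegenerate : forall i p, dom i p -> metric i p \in unitmx;
  metric_change : forall i j p, dom i p -> dom j p ->
    metric i p = jac i j p *m metric j p *m (jac i j p)^T;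
  vol_holomorphic : forall i, holomorphic_on i (dom i) (vol i);
  vol_change : forall i j p, dom i p -> dom j p ->
    vol i p = \det (jac i j p) * vol j p;
  vol_normalised : forall i p, dom i p -> vol i p ^+ 2 = \det (metric i p) }.
End Manifold.

(* The gamma matrices of an orthonormal frame on the spinor spaces S^+ and S^-,*)
(* each of dimension 2^(m-1).  Spinors are rows: gamP a is gamma_{aA'}^B, with *)
(* rows indexed by A' and columns by B, and gamM a is gamma_{aA}^{B'}.         *)
Record clifford_rep (R : realType) (m : nat) := CliffordRep {
  gamP : 'I_(2 * m) -> 'M[Cx R]_(2 ^ m.-1);
  gamM : 'I_(2 * m) -> 'M[Cx R]_(2 ^ m.-1);
  gamPM : forall a b, 2^-1 *: (gamP a *m gamM b + gamP b *m gamM a)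
                      = (- (a == b)%:R)%:M;
  gamMP : forall a b, 2^-1 *: (gamM a *m gamP b + gamM b *m gamP a)
                      = (- (a == b)%:R)%:M }.

Section Clifford.
Variables (R : realType) (m : nat) (cl : clifford_rep R m).
Local Notation C := (Cx R).
Local Notation N := (2 ^ m.-1)%N.
Local Notation n := (2 * m)%N.

(* gamma_{abA'}^{B'} and gamma_{abA}^B *)
Definition gam2P (a b : 'I_n) : 'M[C]_N :=
  2^-1 *: (gamP cl a *m gamM cl b - gamP cl b *m gamM cl a).
Definition gam2M (a b : 'I_n) : 'M[C]_N :=
  2^-1 *: (gamM cl a *m gamP cl b - gamM cl b *m gamP cl a).

(* For a skew connection matrix w_{bc} (fixed direction of differentiation),   *)
(* the spin connection - 1/4 w_{bc} gamma^{bc} makes gamma parallel.           *)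
Lemma gamma_parallel (w : 'I_n -> 'I_n -> C) (e : 'I_n) :
  (forall b c, w b c = - w c b) ->
  - 4^-1 *: (\sum_b \sum_c w b c *: gam2P b c) *m gamP cl e
    + \sum_d w e d *: gamP cl d
  = gamP cl e *m (- 4^-1 *: \sum_b \sum_c w b c *: gam2M b c).
Proof.
move=> hw; pose P := gamP cl; pose Q := gamM cl.
have half (X Y : 'M[C]_N) : 2^-1 *: X = Y -> X = 2 *: Y.
  by move=> <-; rewrite scalerA divff ?pnatr_eq0 // scale1r.
have hPQ b c : P b *m Q c = (- 2 * (b == c)%:R)%:M - P c *m Q b.
  apply/eqP; rewrite -subr_eq opprK; apply/eqP.
  by rewrite (half _ _ (gamPM cl b c)) scale_scalar_mx mulrN mulNr.
have hQP b c : Q b *m P c = (- 2 * (b == c)%:R)%:M - Q c *m P b.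
  apply/eqP; rewrite -subr_eq opprK; apply/eqP.
  by rewrite (half _ _ (gamMP cl b c)) scale_scalar_mx mulrN mulNr.
have hPQP b c : P b *m Q c *m P e
    = P e *m (Q b *m P c) + (2 * (b == e)%:R) *: P c - (2 * (c == e)%:R) *: P b.
  rewrite -mulmxA hQP mulmxBr mulmxA hPQ mulmxBl mul_scalar_mx mul_mx_scalar.
  by rewrite mulmxA !mulNr !scaleNr (eq_sym e b) (addrAC (- _)) addNr add0r addrC.
have hcomm b c : gam2P b c *m P e = P e *m gam2M b c
    + (2 * (b == e)%:R) *: P c - (2 * (c == e)%:R) *: P b.
  rewrite /gam2P /gam2M -scalemxAl -scalemxAr mulmxBl mulmxBr -/P -/Q !hPQP.
  set X := P e *m (Q b *m P c); set Y := P e *m (Q c *m P b).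
  set u := _ *: P c; set v := _ *: P b.
  have -> : X + u - v - (Y + v - u) = (X - Y) + (2 *: u - 2 *: v).
    rewrite -[X + u - v]addrA -[Y + v - u]addrA opprD addrACA.
    by rewrite opprB -scalerBr scaler_nat mulr2n.
  rewrite scalerDr -scalerBr [2^-1 *: (2 *: _)]scalerA mulVf ?pnatr_eq0 //.
  by rewrite scale1r addrA.
rewrite -scalemxAl -scalemxAr mulmx_suml mulmx_sumr.
have -> : \sum_b (\sum_c w b c *: gam2P b c) *m P e
    = \sum_b P e *m (\sum_c w b c *: gam2M b c) + 4 *: \sum_d w e d *: P d.
  transitivity (\sum_b (P e *m (\sum_c w b c *: gam2M b c)
    + \sum_c (w b c * (2 * (b == e)%:R)) *: P c
    - \sum_c (w b c * (2 * (c == e)%:R)) *: P b)).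
    apply: eq_bigr => b _; rewrite mulmx_suml mulmx_sumr -big_split /= -sumrB.
    apply: eq_bigr => c _.
    rewrite -scalemxAl hcomm scalerBr scalerDr -!scalemxAr.
    by rewrite !(scalerA _ _ (P _)).
  rewrite sumrB big_split /= -addrA; congr (_ + _).
  rewrite (bigD1 e) //= [X in _ + X - _]big1 ?addr0; last first.
    by move=> b /negPf ->; rewrite big1 // => c _; rewrite !mulr0 scale0r.
  have -> : \sum_b \sum_c (w b c * (2 * (c == e)%:R)) *: P b
      = - \sum_d (w e d * 2) *: P d.
    rewrite -sumrN; apply: eq_bigr => b _.
    rewrite (bigD1 e) //= big1 ?addr0; last first.
      by move=> c /negPf ->; rewrite !mulr0 scale0r.
    by rewrite eqxx mulr1 hw mulNr scaleNr.
  rewrite opprK -big_split scaler_sumr; apply: eq_bigr => d _ /=.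
  rewrite eqxx mulr1 -scalerDl scalerA; congr (_ *: _); ring.
by rewrite scalerDr scalerA mulNr mulVf ?pnatr_eq0 // scaleN1r addrNK.
Qed.

Definition cvecP (u : 'rV[C]_n) : 'M[C]_N := \sum_a u 0 a *: gamP cl a.
Definition cvecM (u : 'rV[C]_n) : 'M[C]_N := \sum_a u 0 a *: gamM cl a.

(* Spin(2m,C): the products of an even number of unit vectors, acting on       *)
(* S^+ (first matrix) and S^- (second matrix).                                 *)
Inductive spin_group : 'M[C]_N -> 'M[C]_N -> Prop :=
| spin_one : spin_group 1%:M 1%:M
| spin_mul u v h k : u *m u^T = 1%:M -> v *m v^T = 1%:M -> spin_group h k ->
    spin_group (cvecP u *m cvecM v *m h) (cvecM u *m cvecP v *m k).

(* xi_a^A *)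
Definition xi1 (x : 'rV[C]_N) (a : 'I_n) : 'rV[C]_N := x *m gamP cl a.
(* xi_{ab}^{A'} *)
Definition xi2 (x : 'rV[C]_N) (a b : 'I_n) : 'rV[C]_N := x *m gam2P a b.

Definition pure_spinor (x : 'rV[C]_N) : Prop :=
  x != 0 /\ \rank (kermx (\matrix_(a < n) xi1 x a)) = m.

(* Normalised brackets; D is written for the spinor index C, since C is the    *)
(* field.                                                                      *)
Definition skew2 (F : 'I_N -> 'I_N -> C) (A B : 'I_N) : C :=
  2^-1 * (F A B - F B A).
Definition sym2 (F : 'I_N -> 'I_N -> C) (A B : 'I_N) : C :=
  2^-1 * (F A B + F B A).
Definition skew3 (F : 'I_N -> 'I_N -> 'I_N -> C) (A B D : 'I_N) : C :=
  6^-1 * (F A B D + F B D A + F D A B - F B A D - F A D B - F D B A).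

(* Gamma_{abc} xi^{bB} xi^{cC} *)
Definition torsion_of (x : 'rV[C]_N) (G : 'I_n -> 'I_n -> 'I_n -> C)
    (a : 'I_n) (B D : 'I_N) : C :=
  \sum_b \sum_c G a b c * xi1 x b 0 B * xi1 x c 0 D.

(* Isomorphism of Spin(6,C)-modules S^+ = (S^-)^* for m = 3, in matrix form    *)
(* eps_{A'A}; it is unique up to a constant factor.  The equivariance makes    *)
(* the constant matrix eps a bundle isomorphism.                               *)
Definition duality3 (eps : 'M[C]_N) : Prop :=
  [/\ eps \in unitmx,
      (forall h h', spin_group h h' -> h *m eps *m h'^T = eps),
      (forall a, (invmx eps *m gamP cl a)^T = - (invmx eps *m gamP cl a)) &
      (forall a, (gamM cl a *m eps)^T = - (gamM cl a *m eps))].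

(* xi_A, gamma_a^{AB}, gamma_{aAB} and xi_{abD}; for invertible eps,           *)
(* lower eps x *m gamU eps a = xi1 x a.                                        *)
Definition lower (eps : 'M[C]_N) (x : 'rV[C]_N) : 'rV[C]_N := x *m eps.
Definition gamU (eps : 'M[C]_N) (a : 'I_n) : 'M[C]_N := invmx eps *m gamP cl a.
Definition gamL (eps : 'M[C]_N) (a : 'I_n) : 'M[C]_N := gamM cl a *m eps.
Definition xi2L (eps : 'M[C]_N) (x : 'rV[C]_N) (a b : 'I_n) : 'rV[C]_N :=
  2^-1 *: (lower eps x *m
           (gamU eps a *m gamL eps b - gamU eps b *m gamL eps a)).

Section Projections.
Variables (x : 'rV[C]_N) (G : 'I_n -> 'I_n -> 'I_n -> C) (eps : 'M[C]_N).

(* Gamma_{bcd} xi^{cdD'} and, for m = 3, Gamma_{bcd} xi^{cd}_D *)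
Definition Gxi2 (b : 'I_n) : 'rV[C]_N :=
  \sum_c \sum_d G b c d *: xi2 x c d.
Definition Gxi2L (b : 'I_n) : 'rV[C]_N :=
  \sum_c \sum_d G b c d *: xi2L eps x c d.

(* The suffix m32 (resp. m12) stands for the lower index -3/2 (resp. -1/2).    *)
Definition Pi0_m32 : 'I_N -> 'I_N -> 'I_N -> C :=
  skew3 (fun A B D => \sum_a xi1 x a 0 A * torsion_of x G a B D).

Definition Pi1_m32 (A B D : 'I_N) : C :=
  sym2 (fun A' B' => \sum_a xi1 x a 0 A' * torsion_of x G a B' D) A B.

Definition Pi0_m12 (A B : 'I_N) : C :=
  x 0 A * (\sum_b Gxi2 b *m gamP cl b) 0 B - \sum_b xi1 x b 0 B * Gxi2 b 0 A.

Definition Pi1_m12 (a : 'I_n) (B D : 'I_N) : C :=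
  torsion_of x G a B D
  - (2 * (m%:R - 1))^-1 *
    (skew2 (fun B' D' =>
       xi1 x a 0 B' * (\sum_b Gxi2 b *m gamP cl b) 0 D') B D
     + skew2 (fun B' D' =>
       \sum_b xi1 x b 0 B' * (Gxi2 b *m gamP cl a) 0 D') B D).

(* the variant for m = 3 *)
Definition Pi1_m12_3 (a : 'I_n) (B D : 'I_N) : C :=
  torsion_of x G a B D
  - 4^-1 *
    (skew2 (fun B' D' =>
       xi1 x a 0 B' * (\sum_b Gxi2L b *m gamU eps b) 0 D') B D
     + skew2 (fun B' D' =>
       \sum_b xi1 x b 0 B' * (Gxi2L b *m gamU eps a) 0 D') B D)
  + 6^-1 * (\sum_b \sum_A xi1 x b 0 A * Gxi2L b 0 A) * gamU eps a B D.
End Projections.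

End Clifford.

(* A spin structure presented by local sections of the principal Spin bundle.  *)
(* The section over [sdom k] projects to the oriented orthonormal frame whose  *)
(* a-th vector is row a of [frame k], written in the chart [schart k].         *)
(* [stP k l] and [stM k l] are the transition functions: spinors with          *)
(* components psi_k in the k-th spin frame have psi_l = psi_k *m stP k l.      *)
Record spin_structure (R : realType) (m : nat)
    (M : complex_manifold R (2 * m)) (g : holomorphic_metric M)
    (cl : clifford_rep R m) := SpinStructure {
  sidx : Type;
  sdom : sidx -> set M;
  schart : sidx -> chart M;
  frame : sidx -> M -> 'M[Cx R]_(2 * m);
  stP : sidx -> sidx -> M -> 'M[Cx R]_(2 ^ m.-1);
  stM : sidx -> sidx -> M -> 'M[Cx R]_(2 ^ m.-1);
  sdom_open : forall k, open (sdom k);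
  sdom_cover : forall p, exists k, sdom k p;
  sdom_chart : forall k, sdom k `<=` dom (schart k);
  frame_holomorphic : forall k, holomorphic_on (schart k) (sdom k) (frame k);
  frame_orthonormal : forall k p, sdom k p ->
    frame k p *m metric g (schart k) p *m (frame k p)^T = 1%:M;
  frame_oriented : forall k p, sdom k p ->
    \det (frame k p) * vol g (schart k) p = 1;
  stP_holomorphic : forall k l,
    holomorphic_on (schart k) (sdom k `&` sdom l) (stP k l);
  stM_holomorphic : forall k l,
    holomorphic_on (schart k) (sdom k `&` sdom l) (stM k l);
  st_spin : forall k l p, sdom k p -> sdom l p ->
    spin_group cl (stP k l p) (stM k l p);
  stP_cocycle : forall k l r p, sdom k p -> sdom l p -> sdom r p ->
    stP k l p *m stP l r p = stP k r p;
  stM_cocycle : forall k l r p, sdom k p -> sdom l p -> sdom r p ->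
    stM k l p *m stM l r p = stM k r p;
  (* the Spin transition functions lift those of the orthonormal frames *)
  st_covers : forall k l p, sdom k p -> sdom l p ->
    let Lam := frame l p *m jac (schart l) (schart k) p
                 *m invmx (frame k p) in
    forall a,
      stP k l p *m gamP cl a = cvecP cl (row a Lam) *m stM k l p /\
      stM k l p *m gamM cl a = cvecM cl (row a Lam) *m stP k l p }.

Section Spinors.
Context {R : realType} {m : nat} {M : complex_manifold R (2 * m)}
  {g : holomorphic_metric M} {cl : clifford_rep R m}
  (S : spin_structure g cl).
Local Notation C := (Cx R).
Local Notation N := (2 ^ m.-1)%N.
Local Notation n := (2 * m)%N.

(* All tensor and spinor indices below refer to the k-th spin frame.  In it    *)
(* g_{ab} is the identity matrix, so raising a tensor index changes nothing.   *)

(* derivative of the components f along the frame vector e_a *)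
Definition frame_der (W : normedModType C) (k : sidx S) (a : 'I_n)
    (f : M -> W) (p : M) : W :=
  'D_(row a (frame k p)) (f \o coordV (schart k)) (coord (schart k) p).

(* w k p a b c are the coefficients nabla_{e_a} e_b = \sum_c w_{abc} e_c of    *)
(* the metric torsion-free connection.                                         *)
Definition levi_civita (w : sidx S -> M -> 'I_n -> 'I_n -> 'I_n -> C) : Prop :=
  forall k p, sdom k p ->
    (forall a b c, w k p a b c = - w k p a c b) /\
    (forall a b, \sum_c (w k p a b c - w k p b a c) *: row c (frame k p)
       = frame_der k a (fun q => row b (frame k q)) p
         - frame_der k b (fun q => row a (frame k q)) p).

(* A projective spinor field is given by the line L k p of the fibre of S^+    *)
(* over p, expressed in the k-th spin frame.                                   *)
Definition represents (L : sidx S -> M -> set 'rV[C]_N) (k : sidx S)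
    (U : set M) (xi : M -> 'rV[C]_N) : Prop :=
  [/\ open U, U `<=` sdom k, holomorphic_on (schart k) U xi,
      (forall p, U p -> pure_spinor cl (xi p)) &
      (forall p, U p -> L k p = [set c *: xi p | c in [set: C]])].

Definition projective_pure_spinor_field
    (L : sidx S -> M -> set 'rV[C]_N) : Prop :=
  (forall k p, sdom k p -> exists U xi, U p /\ represents L k U xi) /\
  (forall k l p, sdom k p -> sdom l p ->
     L l p = [set x *m stP k l p | x in L k p]).

Section Derivatives.
Variables (w : sidx S -> M -> 'I_n -> 'I_n -> 'I_n -> C) (k : sidx S).

(* The spin connection is - 1/4 w_{abc} gamma^{bc}; this is the sign for which *)
(* gamma is parallel, see [gamma_parallel].                                    *)
Definition nablaSP (a : 'I_n) (xi : M -> 'rV[C]_N) (p : M) : 'rV[C]_N :=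
  frame_der k a xi p
  - 4^-1 *: \sum_b \sum_c w k p a b c *: (xi p *m gam2P cl b c).

(* on (S^-)^*, for fields with a lower index A *)
Definition nablaSMdual (a : 'I_n) (eta : M -> 'rV[C]_N) (p : M) : 'rV[C]_N :=
  frame_der k a eta p
  + 4^-1 *: \sum_b \sum_c w k p a b c *: (eta p *m (gam2M cl b c)^T).

(* nabla_a X^{bB}, for a section X of T (x) S^- *)
Definition nablaTSM (a : 'I_n) (X : M -> 'I_n -> 'rV[C]_N) (b : 'I_n) (p : M) :
    'rV[C]_N :=
  frame_der k a (fun q => X q b) p + \sum_c w k p a c b *: X p c
  - 4^-1 *: \sum_c \sum_d w k p a c d *: (X p b *m gam2M cl c d).

(* nabla_a xi^{bB} *)
Definition nabla_xi1 (xi : M -> 'rV[C]_N) (p : M) (a b : 'I_n) : 'rV[C]_N :=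
  nablaTSM a (fun q => xi1 cl (xi q)) b p.
End Derivatives.

(* G in V (x) so(2m) represents the intrinsic torsion of [xi] at p.  Such a G  *)
(* is determined modulo V (x) p, i.e. modulo the kernel of [torsion_of cl].    *)
Definition intrinsic_torsion (w : sidx S -> M -> 'I_n -> 'I_n -> 'I_n -> C)
    (k : sidx S) (xi : M -> 'rV[C]_N) (p : M)
    (G : 'I_n -> 'I_n -> 'I_n -> C) : Prop :=
  (forall a b c, G a b c = - G a c b) /\
  (forall a B D, torsion_of cl (xi p) G a B D
     = \sum_b nabla_xi1 w k xi p a b 0 B * xi1 cl (xi p) b 0 D).

Section DifferentialConditions.
Variables (w : sidx S -> M -> 'I_n -> 'I_n -> 'I_n -> C) (k : sidx S)
  (xi : M -> 'rV[C]_N) (p : M) (eps : 'M[C]_N).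
Local Notation dxi := (nabla_xi1 w k xi p).
Local Notation xi_ := (xi1 cl (xi p)).

(* (xi^{a[A} nabla_a xi^{bB}) xi_b^{C]} *)
Definition D0_m32 : 'I_N -> 'I_N -> 'I_N -> C :=
  skew3 (fun A B D => \sum_a \sum_b xi_ a 0 A * dxi a b 0 B * xi_ b 0 D).

(* (xi^{a(A} nabla_a xi^{bB)}) xi_b^C *)
Definition D1_m32 (A B D : 'I_N) : C :=
  sym2 (fun A' B' =>
    \sum_a \sum_b xi_ a 0 A' * dxi a b 0 B' * xi_ b 0 D) A B.

(* xi^{A'} nabla_b xi^{bB} - xi^{bB} nabla_b xi^{A'} *)
Definition D0_m12 (A B : 'I_N) : C :=
  xi p 0 A * \sum_b dxi b b 0 B
  - \sum_b xi_ b 0 B * nablaSP w k b xi p 0 A.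

(* xi_a^{[B} nabla_b xi^{bC]} + xi^{b[B} nabla_b xi_a^{C]} *)
Definition D1_skew (a : 'I_n) (B D : 'I_N) : C :=
  skew2 (fun B' D' => xi_ a 0 B' * \sum_b dxi b b 0 D') B D
  + skew2 (fun B' D' => \sum_b xi_ b 0 B' * dxi b a 0 D') B D.

Definition D1_m12 (a : 'I_n) (B D : 'I_N) : C :=
  \sum_b dxi a b 0 B * xi_ b 0 D + 2 / (m%:R - 1) * D1_skew a B D.

(* the variant for m = 3 *)
Definition D1_m12_3 (a : 'I_n) (B D : 'I_N) : C :=
  \sum_b dxi a b 0 B * xi_ b 0 D + D1_skew a B D
  - 2 / 3 *
    (\sum_b \sum_A xi_ b 0 A
       * nablaSMdual w k b (fun q => lower eps (xi q)) p 0 A)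
    * gamU cl eps a B D.
End DifferentialConditions.
End Spinors.

Definition vanish2 (I J : Type) (K : nmodType) (F : I -> J -> K) : Prop :=
  forall i j, F i j = 0.
Definition vanish3 (I J L : Type) (K : nmodType) (F : I -> J -> L -> K) : Prop :=
  forall i j l, F i j l = 0.

(* Main.v *)
Require Import Defs.
From HB Require Import structures.
From mathcomp Require Import all_boot all_order all_algebra.
From mathcomp Require Import complex.
From mathcomp Require Import all_classical all_reals all_analysis.
From mathcomp Require Import ring.

(* Let X be the 2m x 2^(m-1) matrix with rows xi_a, and Y_a the one built from *)
(* y_a = nabla_a xi.  Purity makes ker X maximal isotropic, so X^T X = 0; this *)
(* can be differentiated, so Y_a^T X is skew and factors as X^T G_a X with G_a *)
(* skew: the torsion exists.  Conversely the spinors killed by ker X form a    *)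
(* line, so Y_a^T X = X^T G_a X forces                                         *)
(*   y_a = - 1/4 G_{abc} xi^{bc} + alpha_a xi.                                 *)
(* Substituted into the differential conditions, this gives the corresponding  *)
(* projections up to a nonzero constant: all terms in alpha cancel.  The       *)
(* projections are homogeneous in xi, and rescaling xi only changes alpha and  *)
(* multiplies Y_a^T X by the square of the factor.                             *)

Set Implicit Arguments.
Unset Strict Implicit.
Unset Printing Implicit Defensive.

Local Open Scope classical_set_scope.
Local Open Scope ring_scope.

(** Each differential condition is a nonzero multiple of the matching projection of any torsion [G],
    so the two vanish together. The conditions of weight -3/2 and the leading terms of the others
    contain the derivative only through the Gram matrix of nabla_a xi with xi, which is the torsion
    by definition. The trace terms contain nabla_a xi itself, and for these one needs nabla_a xi = -
    1/4 G_{abc} xi^{bc} + alpha_a xi ([torsion_spinor]). That formula rests on [pure_spinor_line],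
    by which Gram matrices with xi determine a spinor up to multiples of xi, and on [gram_spin],
    which computes the Gram matrix of G_{abc} xi^{bc}.

    The multiples alpha_a then disappear for algebraic reasons: by antisymmetry in [D0_m12E] and
    [D1_skewE], and by skewness of the lowered gamma matrices in [lower_xi1_null]. The constant -1/4
    accounts for the different coefficients on the two sides. Existence of [G]
    ([intrinsic_torsion_exists]) comes from differentiating the quadratic identity
    [pure_spinor_null]. *)

(** * Joint kernels, isotropic kernels and factorisation of skew matrices *)

Section LinearAlgebra.
Variable F : fieldType.

(* Each annihilation operator halves the dimension: on an invariant space its
   image equals its kernel, since k l + l k = 1 and k^2 = 0. *)
Lemma rank_joint_kernel (I : eqType) d (k l : I -> 'M[F]_d) (s : seq I)
    (W : 'M[F]_d) :
  (forall i, k i *m k i = 0) ->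
  (forall i j, k i *m k j = - (k j *m k i)) ->
  (forall i j, l i *m k j + k j *m l i = (i == j)%:R%:M) ->
  (forall i, (W *m k i <= W)%MS) ->
  (forall i, i \in s -> (W *m l i <= W)%MS) ->
  uniq s ->
  exists V : 'M[F]_d, (\rank V * 2 ^ size s)%N = \rank W /\
    (forall u : 'rV_d, (u <= W)%MS -> (forall i, u *m k i = 0) ->
       (u <= V)%MS).
Proof.
move=> kk kC lk; elim: s W => [|i s IH] W Wk Wl /=.
  by exists W; rewrite muln1.
case/andP=> his us; set W' := (W :&: kermx (k i))%MS.
have W'W : (W' <= W)%MS by exact: capmxSl.
have W'k : W' *m k i = 0 by apply/sub_kermxP; exact: capmxSr.
have W'E : (W *m k i :=: W')%MS.
  apply/eqmxP/andP; split.
    by rewrite sub_capmx Wk; apply/sub_kermxP; rewrite -mulmxA kk mulmx0.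
  have -> : W' = W' *m l i *m k i.
    have := lk i i; rewrite eqxx => /(congr1 (mulmx W')).
    by rewrite mulmxDr !mulmxA W'k mul0mx addr0 mulmx1.
  apply: submxMr; apply: submx_trans (Wl i _); last exact: mem_head.
  exact: submxMr.
have W'2 : (\rank W' * 2)%N = \rank W.
  by rewrite -(mxrank_mul_ker W (k i)) -/W' W'E muln2 addnn.
have [||//|V [rV hV]] := IH W'.
- move=> j; rewrite sub_capmx (submx_trans (submxMr _ W'W)) //.
  apply/sub_kermxP; rewrite -mulmxA kC mulmxN mulmxA W'k.
  by rewrite mul0mx oppr0.
- move=> j js; rewrite sub_capmx (submx_trans (submxMr _ W'W)); last first.
    by apply: Wl; rewrite inE js orbT.
  apply/sub_kermxP; have := lk j i.
  case: (eqVneq j i) => [ji|_ /eqP]; first by rewrite -ji js in his.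
  rewrite raddf0 addr_eq0 => /eqP h.
  by rewrite -mulmxA h mulmxN mulmxA W'k mul0mx oppr0.
exists V; split; first by rewrite expnSr mulnA rV.
move=> u uW uk; apply: hV => //; rewrite sub_capmx uW.
by apply/sub_kermxP.
Qed.

(** An isotropic subspace of half the dimension is its own orthogonal complement. The columns of [A]
    are orthogonal to its kernel, hence lie in it; this is [A^T *m A = 0] in submodule form. *)
Lemma isotropic_kernel n m p (A : 'M[F]_(n, p)) :
  n = (2 * m)%N -> \rank (kermx A) = m -> kermx A *m (kermx A)^T = 0 ->
  (A^T <= kermx A)%MS.
Proof.
move=> En rK KK; have KK' : (kermx A <= kermx (kermx A)^T)%MS.
  exact/sub_kermxP.
have K'K : (kermx (kermx A)^T <= kermx A)%MS.
  rewrite -(mxrank_leqif_sup KK').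
  by rewrite [\rank (kermx _^T)]mxrank_ker mxrank_tr rK En mul2n -addnn addnK.
apply: submx_trans K'K; apply/sub_kermxP.
by rewrite -trmx_mul mulmx_ker trmx0.
Qed.

(** The rows of [T = Y^T *m X] lie in the row space of [X], and by skewness so do its columns after
    transposition. Compressing [T] on both sides with a pseudo-inverse of [X] therefore loses
    nothing and preserves skewness. *)
Lemma skew_factor n p (X : 'M[F]_(n, p)) (Y : 'M[F]_(n, p)) :
  Y^T *m X = - (X^T *m Y) ->
  exists G : 'M[F]_n, G^T = - G /\ X^T *m G *m X = Y^T *m X.
Proof.
move=> YX; set T := Y^T *m X; have Tt : T^T = - T.
  by rewrite /T trmx_mul trmxK YX opprK.
have TX : T *m pinvmx X *m X = T by rewrite mulmxKpV // submxMl.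
clearbody T; move: (pinvmx X) TX => X1 TX.
exists (X1^T *m T *m X1); split.
  by rewrite 2!trmx_mul trmxK Tt mulNmx mulmxN mulmxA.
rewrite -!mulmxA (mulmxA T) TX mulmxA -trmx_mul.
by rewrite -{1}[T]opprK mulmxN -Tt -trmx_mul mulmxA TX Tt opprK.
Qed.

Lemma skew_form_null d (z : 'rV[F]_d) (Q : 'M[F]_d) :
  (2 : F) != 0 -> Q^T = - Q -> z *m Q *m z^T = 0.
Proof.
move=> h2 Qs; apply/matrixP => i j; rewrite !ord1 [RHS]mxE.
have : (z *m Q *m z^T)^T = - (z *m Q *m z^T).
  by rewrite trmx_mul trmxK trmx_mul Qs mulNmx mulmxN mulmxA.
move: (z *m Q *m z^T) => A /matrixP/(_ 0 0); rewrite !mxE => /eqP.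
by rewrite -addr_eq0 -mulr2n -mulr_natr mulf_eq0 (negPf h2) orbF => /eqP.
Qed.

Lemma proportional d (x z : 'rV[F]_d) :
  x != 0 -> (forall i j, z 0 i * x 0 j = z 0 j * x 0 i) ->
  exists c, z = c *: x.
Proof.
move=> x0 h; have [j xj] : exists j, x 0 j != 0.
  apply/existsP; apply: contra_neqT x0 => /existsPn xj.
  by apply/rowP => j; rewrite mxE; have := xj j; rewrite negbK => /eqP.
exists (z 0 j / x 0 j); apply/rowP => i; rewrite mxE mulrAC -h.
by rewrite mulfK.
Qed.
End LinearAlgebra.

(** * Algebra of pure spinors: nullity, and the line they span *)

Section PureSpinors.
Variables (R : realType) (m : nat) (cl : clifford_rep R m).
Local Notation C := (Cx R).
Local Notation N := (2 ^ m.-1)%N.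
Local Notation n := (2 * m)%N.
Implicit Types (x y z : 'rV[C]_N) (u v : 'rV[C]_n).

Definition xi1_mx x : 'M[C]_(n, N) := \matrix_(a < n) xi1 cl x a.

Fact xi1_mx_is_linear : linear xi1_mx.
Proof.
move=> c x y; apply/row_matrixP => a.
by rewrite linearP /= !rowK /xi1 mulmxDl scalemxAl.
Qed.
HB.instance Definition _ := GRing.isLinear.Build C 'rV[C]_N 'M[C]_(n, N) _
  xi1_mx xi1_mx_is_linear.

Lemma mul_xi1_mx u x : u *m xi1_mx x = x *m cvecP cl u.
Proof.
rewrite mulmx_sum_row /cvecP mulmx_sumr; apply: eq_bigr => a _.
by rewrite rowK -scalemxAr.
Qed.

Lemma gram_xi1_mx x y B D :
  ((xi1_mx y)^T *m xi1_mx x) B D = \sum_b xi1 cl y b 0 B * xi1 cl x b 0 D.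
Proof. by rewrite mxE; apply: eq_bigr => b _; rewrite !mxE. Qed.

Lemma cvec_anticomm (P Q : 'I_n -> 'M[C]_N) u v :
  (forall a b, 2^-1 *: (P a *m Q b + P b *m Q a) = (- (a == b)%:R)%:M) ->
  (\sum_a u 0 a *: P a) *m (\sum_a v 0 a *: Q a)
  + (\sum_a v 0 a *: P a) *m (\sum_a u 0 a *: Q a)
  = (- 2 * (u *m v^T) 0 0)%:M.
Proof.
move=> PQ; rewrite !mulmx_suml.
under eq_bigr do rewrite mulmx_sumr.
under [X in _ + X]eq_bigr do rewrite mulmx_sumr.
rewrite [X in _ + X]exchange_big -big_split /=.
under eq_bigr => a _ do rewrite -big_split /=.
transitivity (\sum_a \sum_b (- 2 * (u 0 a * v 0 b * (a == b)%:R))%:M : 'M[C]_N).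
  apply: eq_bigr => a _; apply: eq_bigr => b _.
  have -> : (- 2 * (u 0 a * v 0 b * (a == b)%:R))%:M
      = (2 * (u 0 a * v 0 b)) *: (- (a == b)%:R)%:M :> 'M[C]_N.
    by rewrite scale_scalar_mx; congr (_%:M); ring.
  rewrite -PQ scalerA mulrAC divff ?pnatr_eq0 // mul1r scalerDr.
  rewrite -!scalemxAl -!scalemxAr !scalerA.
  by rewrite (mulrC (v 0 b)).
under eq_bigr do rewrite -raddf_sum /=.
rewrite -raddf_sum /=; congr (_%:M); rewrite mxE mulr_sumr.
apply: eq_bigr => a _; rewrite (bigD1 a) //= big1 ?addr0 ?eqxx ?mulr1 ?mxE //.
by move=> b ba; rewrite eq_sym (negPf ba) !mulr0.
Qed.

(* Clifford multiplication by u on the whole spinor space S^+ + S^-. *)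
Definition cvec u : 'M[C]_(N + N) := block_mx 0 (cvecP cl u) (cvecM cl u) 0.

Lemma cvecC u v : cvec u *m cvec v + cvec v *m cvec u
  = (- 2 * (u *m v^T) 0 0)%:M.
Proof.
rewrite /cvec !mulmx_block !mul0mx !mulmx0 !add0r !addr0 add_block_mx !addr0.
rewrite (cvec_anticomm _ _ (gamPM cl)) (cvec_anticomm _ _ (gamMP cl)).
by rewrite -scalar_mx_block.
Qed.

Lemma row_mx_cvec x u : row_mx x 0 *m cvec u = row_mx 0 (x *m cvecP cl u).
Proof. by rewrite mul_row_block !mulmx0 mul0mx !addr0. Qed.

(** Applied to [x], the Clifford relation for [u] and [v] has a vanishing left-hand side and leaves
    -2 (u.v) x = 0. *)
Lemma pure_spinor_ker_isotropic x u v : x != 0 ->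
  x *m cvecP cl u = 0 -> x *m cvecP cl v = 0 -> u *m v^T = 0.
Proof.
move=> x0 xu xv; have := cvecC u v => /(congr1 (mulmx (row_mx x 0))).
rewrite mulmxDr !mulmxA !row_mx_cvec xu xv !row_mx0 !mul0mx addr0.
rewrite mul_mx_scalar scale_row_mx scaler0 -row_mx0 => /eq_row_mx[+ _].
move/esym/eqP; rewrite scaler_eq0 (negPf x0) orbF mulf_eq0 oppr_eq0 pnatr_eq0.
by move=> /eqP h; apply/matrixP => i j; rewrite !ord1 h mxE.
Qed.

Lemma pure_spinor_ker x : pure_spinor cl x ->
  kermx (xi1_mx x) *m (kermx (xi1_mx x))^T = 0.
Proof.
move=> [x0 _]; apply/matrixP => a b; set K := kermx _.
have xK c : x *m cvecP cl (row c K) = 0.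
  by rewrite -mul_xi1_mx -row_mul mulmx_ker row0.
transitivity ((row a K *m (row b K)^T) 0 0).
  by rewrite !mxE; apply: eq_bigr => c _; rewrite !mxE.
by rewrite (pure_spinor_ker_isotropic x0) // !mxE.
Qed.

Lemma pure_spinor_null x : pure_spinor cl x -> (xi1_mx x)^T *m xi1_mx x = 0.
Proof.
move=> px; apply/sub_kermxP; apply: (isotropic_kernel (erefl _)); last first.
  exact: pure_spinor_ker.
by case: px.
Qed.

(* On the 2^m-dimensional spinor space, the m anticommuting operators cvec u, *)
(* for u in a basis of ker (xi1_mx x), have a common kernel of dimension 1.   *)
Lemma pure_spinor_line x z : (0 < m)%N -> pure_spinor cl x ->
  (xi1_mx z)^T *m xi1_mx x = 0 -> exists c, z = c *: x.
Proof.
move=> m0 px zx; have [x0 rK] := px.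
set K := row_base (kermx (xi1_mx x)).
have KX : K *m xi1_mx x = 0.
  by apply/sub_kermxP; rewrite eq_row_base.
have zK : K *m xi1_mx z = 0.
  (* The columns of [xi1_mx z] lie in the kernel of [xi1_mx x], which is isotropic; hence every
     vector annihilating [x] also annihilates [z]. *)
  have /submxP[A hA] : ((xi1_mx z)^T <= kermx (xi1_mx x))%MS by apply/sub_kermxP.
  have /submxP[B ->] : (K <= kermx (xi1_mx x))%MS by rewrite eq_row_base.
  rewrite -[xi1_mx z]trmxK hA trmx_mul mulmxA -(mulmxA B).
  by rewrite pure_spinor_ker // mulmx0 mul0mx.
have xk i : x *m cvecP cl (row i K) = 0.
  by rewrite -mul_xi1_mx -row_mul KX row0.
have zk i : z *m cvecP cl (row i K) = 0.
  by rewrite -mul_xi1_mx -row_mul zK row0.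
(* The rows of [L] are dual to the basis [K]. Multiplied by [- 2^-1], their Clifford actions become
   creation operators for the annihilation operators given by [K]. *)
set L := (pinvmx K)^T; have KL : K *m L^T = 1%:M.
  by rewrite trmxK mulmxVp // row_base_free.
clearbody L.
have half (A : 'M[C]_(N + N)) : A + A = 0 -> A = 0.
  move/eqP; rewrite -mulr2n -scaler_nat scaler_eq0 pnatr_eq0 /=.
  by move/eqP.
have kk i j : cvec (row i K) *m cvec (row j K)
    = - (cvec (row j K) *m cvec (row i K)).
  apply/eqP; rewrite -addr_eq0 cvecC (pure_spinor_ker_isotropic x0) //.
  by rewrite mxE mulr0 raddf0.
have [//||||||V [rV hV]] := rank_joint_kernel
    (k := fun i => cvec (row i K)) (l := fun i => - 2^-1 *: cvec (row i L))
    (s := enum 'I_(\rank (kermx (xi1_mx x)))) (W := 1%:M).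
- by move=> i; apply: half; rewrite {1}kk addNr.
- exact: kk.
- move=> i j; rewrite -scalemxAl -scalemxAr -scalerDr cvecC scale_scalar_mx.
  rewrite mulrA mulrNN mulVf ?pnatr_eq0 // mul1r; congr (_%:M).
  transitivity ((K *m L^T) j i); last by rewrite KL mxE eq_sym.
  by rewrite !mxE; apply: eq_bigr => a _; rewrite !mxE mulrC.
- by move=> i; exact: submx1.
- by move=> i _; exact: submx1.
- exact: enum_uniq.
have {}rV : \rank V = 1%N.
  (* The predecessor in [N] is truncated, so [0 < m] enters here. Halving dimension 2^m exactly m
     times leaves a line. *)
  have NN : (N + N = 2 ^ m)%N by rewrite addnn -mul2n -expnS prednK.
  move: rV; rewrite size_enum_ord rK mxrank1 [RHS]NN => /eqP.
  by rewrite -[X in _ == X]mul1n eqn_pmul2r ?expn_gt0 // => /eqP.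
have inV y : (forall i, y *m cvecP cl (row i K) = 0) -> (row_mx y 0 <= V)%MS.
  move=> hy; apply: hV (submx1 _) _ => i.
  by rewrite row_mx_cvec hy row_mx0.
have xz : (row_mx z 0 <= row_mx x (0 : 'rV_N))%MS.
  have xV := inV x xk; apply: submx_trans (inV z zk) _.
  rewrite -(mxrank_leqif_sup xV) rV rank_rV.
  suff -> : row_mx x (0 : 'rV_N) != 0 by [].
  by apply: contra_neq x0; rewrite -row_mx0 => /eq_row_mx[].
have /sub_rVP[c] := xz; rewrite scale_row_mx => /eq_row_mx[-> _].
by exists c.
Qed.

End PureSpinors.

(** * Derivatives of linear and bilinear expressions in vector-valued functions *)

Section Derivatives.
Variable K : numFieldType.

Lemma linear_mx_continuous m n (W : normedModType K)
  (h : {linear 'M[K]_(m, n) -> W}) : continuous h.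
Proof.
have hE : (h : _ -> W) = (fun x => \sum_i \sum_j x i j *: h (delta_mx i j)).
  apply/funext => x; rewrite [in LHS](matrix_sum_delta x) linear_sum.
  apply: eq_bigr => i _; rewrite linear_sum; apply: eq_bigr => j _.
  by rewrite linearZ_LR.
rewrite hE.
apply: continuous_big => [|i _]; first exact: add_continuous.
apply: continuous_big => [|j _]; first exact: add_continuous.
by move=> x; apply: continuousZr_tmp; exact: coord_continuous.
Qed.

Lemma derive_linear m n (V W : normedModType K) (f : V -> 'M[K]_(m, n))
  (h : {linear 'M[K]_(m, n) -> W}) z v :
  differentiable f z -> 'D_v (h \o f) z = h ('D_v f z).
Proof.
move=> df; have dh : differentiable h (f z).
  exact/linear_differentiable/linear_mx_continuous.
rewrite deriveE; last exact: differentiable_comp.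
rewrite diff_comp // diff_lin; last exact: linear_mx_continuous.
by rewrite /= deriveE.
Qed.

(** The codomain [K^o] makes this a linear map into a normed module, as [derive_linear] requires. *)
Definition entry m n (i : 'I_m) (j : 'I_n) (A : 'M[K]_(m, n)) : K^o := A i j.

Fact entry_is_linear m n i j : linear (@entry m n i j).
Proof. by move=> c A B; rewrite /entry !mxE. Qed.
HB.instance Definition _ m n i j := GRing.isLinear.Build K 'M[K]_(m, n) K^o _
  (@entry m n i j) (entry_is_linear i j).

Lemma derive_entry d (V : normedModType K) (f : V -> 'rV[K]_d) z v i :
  differentiable f z -> is_derive z v (fun q => f q 0 i : K) (('D_v f z) 0 i).
Proof.
move=> df; have dfi : differentiable (fun q => f q 0 i : K) z.
  apply: (differentiable_comp (g := fun N : 'rV[K]_d => N 0 i : K)) => //.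
  exact: differentiable_coord.
apply: DeriveDef; first exact: diff_derivable.
exact: (@derive_linear _ _ _ K f (@entry 1 d 0 i) z v).
Qed.

Lemma mulmx_bilinear d (u v : 'rV[K]_d) (c : 'M[K]_d) i j :
  (u *m c *m v^T) i j = \sum_i \sum_j c i j * (u 0 i * v 0 j).
Proof.
rewrite exchange_big !ord1 mxE; apply: eq_bigr => b _ /=.
rewrite !mxE mulr_suml; apply: eq_bigr => a _.
by rewrite mulrCA mulrA.
Qed.

Lemma derive_bilinear0 d (V : normedModType K) (f g : V -> 'rV[K]_d)
  (c : 'M[K]_d) z v :
  differentiable f z -> differentiable g z ->
  (\forall q \near z, f q *m c *m (g q)^T = 0) ->
  'D_v f z *m c *m (g z)^T + f z *m c *m ('D_v g z)^T = 0.
Proof.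
move=> df dg fg0.
pose fi i q : K := f q 0 i; pose gi i q : K := g q 0 i.
(* The sum is taken in the space of functions, the form to which [is_derive_sum] applies. *)
pose H : V -> K := \sum_i \sum_j c i j *: (fi i * gi j).
have HE q : H q = (f q *m c *m (g q)^T) 0 0.
  rewrite mulmx_bilinear /H fct_sumE; apply: eq_bigr => i _.
  by rewrite fct_sumE.
have dfi i : is_derive z v (fi i) (('D_v f z) 0 i) by exact: derive_entry.
have dgi i : is_derive z v (gi i) (('D_v g z) 0 i) by exact: derive_entry.
have dH : is_derive z v H (\sum_i \sum_j
    c i j *: (fi i z *: ('D_v g z) 0 j + gi j z *: ('D_v f z) 0 i)).
  by apply: is_derive_sum => i; apply: is_derive_sum.
have : 'D_v H z = 0.
  rewrite (@near_eq_derive _ _ _ _ (cst 0)) ?derive_cst //.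
  by apply: filterS fg0 => q fgq; rewrite HE fgq mxE.
rewrite derive_val => H0; apply/matrixP => a b.
rewrite [LHS]mxE !mulmx_bilinear [RHS]mxE -[RHS]H0 -big_split /=.
apply: eq_bigr => i _; rewrite -big_split; apply: eq_bigr => j _ /=.
by rewrite /fi /gi /GRing.scale /=; ring.
Qed.
End Derivatives.

(** * The infinitesimal spin action, and recovering a spinor from its Gram matrix *)

Section SpinAction.
Variables (R : realType) (m : nat) (cl : clifford_rep R m).
Local Notation C := (Cx R).
Local Notation N := (2 ^ m.-1)%N.
Local Notation n := (2 * m)%N.
Implicit Types (x y z : 'rV[C]_N) (w : 'I_n -> 'I_n -> C).

Definition conn_mx w : 'M[C]_n := \matrix_(b, c) w b c.

Lemma conn_mx_skew w :
  (forall b c, w b c = - w c b) -> (conn_mx w)^T = - conn_mx w.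
Proof. by move=> ws; apply/matrixP => b c; rewrite !mxE ws. Qed.

(** This is [gamma_parallel] applied to [x]: the skew matrix [w] acts on S^+, on S^- and on vectors
    compatibly with Clifford multiplication. *)
Lemma xi1_spin x w e : (forall b c, w b c = - w c b) ->
  xi1 cl (4^-1 *: \sum_b \sum_c w b c *: xi2 cl x b c) e
  = xi1 cl x e *m (4^-1 *: \sum_b \sum_c w b c *: gam2M cl b c)
    + \sum_d w e d *: xi1 cl x d.
Proof.
move=> ws; rewrite /xi1.
have -> : 4^-1 *: (\sum_b \sum_c w b c *: xi2 cl x b c)
    = x *m (4^-1 *: \sum_b \sum_c w b c *: gam2P cl b c).
  rewrite -scalemxAr mulmx_sumr; congr (_ *: _); apply: eq_bigr => b _.
  by rewrite mulmx_sumr; apply: eq_bigr => c _; rewrite -scalemxAr.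
have -> : \sum_d w e d *: (x *m gamP cl d) = x *m \sum_d w e d *: gamP cl d.
  by rewrite mulmx_sumr; apply: eq_bigr => d _; rewrite -scalemxAr.
rewrite -!mulmxA -mulmxDr; congr (x *m _).
have opp (P Q T U : 'M[C]_N) :
    - 4^-1 *: P *m U + T = U *m (- 4^-1 *: Q) ->
    4^-1 *: P *m U = U *m (4^-1 *: Q) + T.
  rewrite (scaleNr _ P) (scaleNr _ Q) mulNmx mulmxN.
  by move=> /(canRL (addKr _)) ->; rewrite opprK addrCA subrr addr0.
by apply: opp; exact: gamma_parallel.
Qed.

Lemma xi1_mx_spin x w : (forall b c, w b c = - w c b) ->
  xi1_mx cl (4^-1 *: \sum_b \sum_c w b c *: xi2 cl x b c)
  = xi1_mx cl x *m (4^-1 *: \sum_b \sum_c w b c *: gam2M cl b c)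
    + conn_mx w *m xi1_mx cl x.
Proof.
move=> ws; apply/row_matrixP => e.
rewrite linearD /= !row_mul !rowK xi1_spin //; congr (_ + _).
rewrite mulmx_sum_row; apply: eq_bigr => d _.
by rewrite !rowK !mxE.
Qed.

(** The S^- part of the action is killed by nullity of [x]; only the rotation of the vector index
    survives, and transposing [w] gives the sign. This is why the torsion enters the derivative of
    the spinor with factor -1/4. *)
Lemma gram_spin x w : (forall b c, w b c = - w c b) ->
  (xi1_mx cl x)^T *m xi1_mx cl x = 0 ->
  (xi1_mx cl (4^-1 *: \sum_b \sum_c w b c *: xi2 cl x b c))^T *m xi1_mx cl x
  = - ((xi1_mx cl x)^T *m conn_mx w *m xi1_mx cl x).
Proof.
move=> ws null; rewrite xi1_mx_spin // linearD /=.
rewrite trmx_mul (trmx_mul (conn_mx w)) mulmxDl.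
rewrite -(mulmxA _ (xi1_mx cl x)^T) null mulmx0 add0r.
by rewrite conn_mx_skew // mulmxN mulNmx.
Qed.

Lemma torsion_ofE x G a B D : torsion_of cl x G a B D
  = ((xi1_mx cl x)^T *m conn_mx (G a) *m xi1_mx cl x) B D.
Proof.
rewrite /torsion_of exchange_big mxE; apply: eq_bigr => c _ /=.
rewrite !mxE mulr_suml; apply: eq_bigr => b _; rewrite !mxE.
by rewrite [G _ _ _ * _]mulrC.
Qed.

(** By [gram_spin], the sum of [y a] and a quarter of [Gxi2] has zero Gram matrix with [x], so it
    lies on the line of [x]. *)
Lemma torsion_spinor x G (y : 'I_n -> 'rV[C]_N) : (0 < m)%N ->
  pure_spinor cl x -> (forall a b c, G a b c = - G a c b) ->
  (forall a, (xi1_mx cl x)^T *m conn_mx (G a) *m xi1_mx cl x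
    = (xi1_mx cl (y a))^T *m xi1_mx cl x) ->
  exists al : 'I_n -> C, forall a, y a = - 4^-1 *: Gxi2 cl x G a + al a *: x.
Proof.
move=> m0 px Gs Gy; suff h a : exists c, y a = - 4^-1 *: Gxi2 cl x G a + c *: x.
  exists (fun a => projT1 (cid (h a))) => a; exact: projT2 (cid (h a)).
have [|c hc] := @pure_spinor_line _ _ cl x (y a + 4^-1 *: Gxi2 cl x G a) m0 px.
  rewrite linearD /= linearD /= mulmxDl -Gy gram_spin ?subrr //.
  exact: pure_spinor_null.
by exists c; rewrite -hc scaleNr addrCA addNr addr0.
Qed.

End SpinAction.

(** * Covariant derivatives of pure spinor fields *)

Section Geometry.
Variables (R : realType) (m : nat) (M : complex_manifold R (2 * m)).
Variables (g : holomorphic_metric M) (cl : clifford_rep R m).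
Variables (S : spin_structure g cl).
Local Notation C := (Cx R).
Local Notation N := (2 ^ m.-1)%N.
Local Notation n := (2 * m)%N.
Implicit Types (k : sidx S) (U : set M) (xi : M -> 'rV[C]_N) (p : M).

Lemma near_coordV k U p : open U -> U `<=` sdom k -> U p ->
  \forall z \near Defs.coord (schart k) p, U (coordV (schart k) z).
Proof.
move=> oU Uk pU; have pd := sdom_chart (Uk _ pU).
apply: (coordV_continuous pd); rewrite coordK //.
exact: open_nbhs_nbhs.
Qed.

Lemma frame_der_mulmx k a xi p (A : 'M[C]_N) :
  differentiable (xi \o coordV (schart k)) (Defs.coord (schart k) p) ->
  frame_der k a (fun q => xi q *m A) p = frame_der k a xi p *m A.
Proof. exact: (@derive_linear _ _ _ _ _ _ (mulmxr A)). Qed.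

Section Connection.
Variables (w : sidx S -> M -> 'I_n -> 'I_n -> 'I_n -> C).
Hypothesis hw : levi_civita w.

(** Gamma is parallel, so the derivative falls on the spinor alone. *)
Lemma nabla_xi1E k xi p a b : sdom k p ->
  differentiable (xi \o coordV (schart k)) (Defs.coord (schart k) p) ->
  nabla_xi1 w k xi p a b = xi1 cl (nablaSP w k a xi p) b.
Proof.
move=> kp dxi; have [ws _] := hw kp.
rewrite /nabla_xi1 /nablaTSM frame_der_mulmx // [in RHS]/xi1 mulmxBl.
rewrite -addrA; congr (_ + _).
have := @xi1_spin _ _ cl (xi p) (w k p a) b (ws a).
rewrite {1}/xi1 => ->; rewrite opprD addrC -scalemxAr mulmx_sumr.
congr (- (_ *: _) + _).
  apply: eq_bigr => c _; rewrite mulmx_sumr; apply: eq_bigr => d _.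
  by rewrite [RHS](esym (scalemxAr _ _ _)).
by rewrite -sumrN; apply: eq_bigr => c _; rewrite ws scaleNr.
Qed.

(** This is the derivative of the identity [pure_spinor_null], valid throughout [U]. The partial
    derivatives obey the product rule, and the connection terms cancel by [gram_spin]. *)
Lemma nablaSP_gram_skew k U xi p a : open U -> U `<=` sdom k ->
  holomorphic_on (schart k) U xi ->
  (forall q, U q -> pure_spinor cl (xi q)) -> U p ->
  (xi1_mx cl (nablaSP w k a xi p))^T *m xi1_mx cl (xi p)
  = - ((xi1_mx cl (xi p))^T *m xi1_mx cl (nablaSP w k a xi p)).
Proof.
move=> oU Uk hol pure pU; have dxi := hol _ pU.
have pd := sdom_chart (Uk _ pU).
have [ws _] := hw (Uk _ pU).
set X := xi1_mx cl (xi p); set d := frame_der k a xi p.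
have Xd : (xi1_mx cl d)^T *m X + X^T *m xi1_mx cl d = 0.
  apply/matrixP => B D.
  (* [c] is the bilinear form on S^+ whose value is the (B, D) entry of the Gram matrix. *)
  pose c := \sum_b col B (gamP cl b) *m (col D (gamP cl b))^T.
  have cE x y : (x *m c *m y^T) 0 0 = ((xi1_mx cl x)^T *m xi1_mx cl y) B D.
    rewrite gram_xi1_mx /c mulmx_sumr mulmx_suml summxE; apply: eq_bigr => b _.
    rewrite mulmxA -mulmxA -trmx_mul [LHS]mxE big_ord1 !mxE.
    by congr (_ * _); apply: eq_bigr => i _; rewrite !mxE.
  have := @derive_bilinear0 _ _ _ _ _ c _ (row a (frame k p)) dxi dxi.
  rewrite -/(frame_der k a xi p) /= coordK // -/d => h.
  have {}h : d *m c *m (xi p)^T + xi p *m c *m d^T = 0.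
    apply: h; have := near_coordV oU Uk pU; apply: filterS => q /pure pq.
    by apply/matrixP => i j; rewrite !ord1 cE pure_spinor_null // !mxE.
  by rewrite [LHS]mxE [RHS]mxE -!cE; move/matrixP/(_ 0 0): h; rewrite !mxE.
apply/eqP; rewrite -addr_eq0; apply/eqP.
have null : X^T *m X = 0 by apply: pure_spinor_null; exact: pure.
have sp := gram_spin (ws a) null.
rewrite /nablaSP -/d -/X linearB /= linearB /= mulmxBl mulmxBr addrACA Xd add0r.
rewrite -opprD -[RHS]oppr0; congr (- _).
have sp' := congr1 trmx sp; rewrite trmx_mul trmxK in sp'.
rewrite sp sp' linearN /= !trmx_mul trmxK (conn_mx_skew (ws a)).
by rewrite mulNmx mulmxN opprK mulmxA addNr.
Qed.

End Connection.
End Geometry.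

(** * Homogeneity of the projections in the spinor: degree 3 for weight -3/2, degree 2 for weight
    -1/2 *)

Lemma scalemxE (K : pzRingType) p q (c : K) (A : 'M[K]_(p, q)) i j :
  (c *: A) i j = c * A i j.
Proof. by rewrite mxE. Qed.

Lemma vanish2_scale (I J : Type) (K : idomainType) (F F' : I -> J -> K) (c : K) :
  c != 0 -> (forall i j, F' i j = c * F i j) -> vanish2 F <-> vanish2 F'.
Proof.
move=> c0 FF; split=> v i j; first by rewrite FF v mulr0.
by apply: (mulfI c0); rewrite -FF v mulr0.
Qed.

Lemma vanish3_scale (I J L : Type) (K : idomainType) (F F' : I -> J -> L -> K)
    (c : K) :
  c != 0 -> (forall i j l, F' i j l = c * F i j l) ->
  vanish3 F <-> vanish3 F'.
Proof.
move=> c0 FF; split=> v i j l; first by rewrite FF v mulr0.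
by apply: (mulfI c0); rewrite -FF v mulr0.
Qed.

Section Scalars.
Variable K : comPzRingType.
Implicit Types c d f g s t u v : K.

Fact mul_scaled f u v u' v' : u' = f * u -> v' = f * v ->
  u' * v' = f ^+ 2 * (u * v).
Proof. by move=> -> ->; ring. Qed.

Fact comb_scaled f c t s u t' s' u' : t' = f * t -> s' = f * s -> u' = f * u ->
  t' - c * (s' + u') = f * (t - c * (s + u)).
Proof. by move=> -> -> ->; ring. Qed.

Fact comb_scaled3 f c d g t s u v t' s' u' v' :
  t' = f * t -> s' = f * s -> u' = f * u -> v' = f * v ->
  t' - c * (s' + u') + d * v' * g = f * (t - c * (s + u) + d * v * g).
Proof. by move=> -> -> -> ->; ring. Qed.

Fact sum_scaled (I : finType) f (F F' : I -> K) :
  (forall i, F' i = f * F i) -> \sum_i F' i = f * \sum_i F i.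
Proof. by move=> FF; rewrite mulr_sumr; apply: eq_bigr => i _. Qed.
End Scalars.

Section Homogeneity.
Variables (R : realType) (m : nat) (cl : clifford_rep R m).
Local Notation C := (Cx R).
Local Notation N := (2 ^ m.-1)%N.
Local Notation n := (2 * m)%N.
Variables (x : 'rV[C]_N) (G : 'I_n -> 'I_n -> 'I_n -> C) (f : C).

Lemma skew2Z (F F' : 'I_N -> 'I_N -> C) c :
  (forall B D, F' B D = c * F B D) ->
  forall B D, skew2 F' B D = c * skew2 F B D.
Proof. by move=> FF B D; rewrite /skew2 !FF; ring. Qed.

Lemma sym2Z (F F' : 'I_N -> 'I_N -> C) c :
  (forall B D, F' B D = c * F B D) ->
  forall B D, sym2 F' B D = c * sym2 F B D.
Proof. by move=> FF B D; rewrite /sym2 !FF; ring. Qed.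

Lemma skew3Z (F F' : 'I_N -> 'I_N -> 'I_N -> C) c :
  (forall A B D, F' A B D = c * F A B D) ->
  forall A B D, skew3 F' A B D = c * skew3 F A B D.
Proof. by move=> FF A B D; rewrite /skew3 !FF; ring. Qed.

Lemma xi1Z a B : xi1 cl (f *: x) a 0 B = f * xi1 cl x a 0 B.
Proof. by rewrite /xi1 -scalemxAl; exact: scalemxE. Qed.

Lemma Gxi2Z b : Gxi2 cl (f *: x) G b = f *: Gxi2 cl x G b.
Proof.
rewrite /Gxi2 scaler_sumr; apply: eq_bigr => c _; rewrite scaler_sumr.
by apply: eq_bigr => d _; rewrite /xi2 -scalemxAl !scalerA mulrC.
Qed.

Lemma Gxi2_entryZ b A : Gxi2 cl (f *: x) G b 0 A = f * Gxi2 cl x G b 0 A.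
Proof. by rewrite Gxi2Z; exact: scalemxE. Qed.

Lemma Gxi2_mulZ b (P : 'M[C]_N) D :
  (Gxi2 cl (f *: x) G b *m P) 0 D = f * (Gxi2 cl x G b *m P) 0 D.
Proof. by rewrite Gxi2Z -scalemxAl; exact: scalemxE. Qed.

Lemma trace_Gxi2Z D : (\sum_b Gxi2 cl (f *: x) G b *m gamP cl b) 0 D
  = f * (\sum_b Gxi2 cl x G b *m gamP cl b) 0 D.
Proof.
rewrite [LHS]summxE [X in _ * X]summxE mulr_sumr.
by apply: eq_bigr => b _; exact: Gxi2_mulZ.
Qed.

Lemma torsion_ofZ a B D :
  torsion_of cl (f *: x) G a B D = f ^+ 2 * torsion_of cl x G a B D.
Proof.
rewrite /torsion_of mulr_sumr; apply: eq_bigr => b _; rewrite mulr_sumr.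
by apply: eq_bigr => c _; rewrite !xi1Z (mulrCA _ f) !mulrA (mulrAC _ _ f).
Qed.

Lemma xi_torsionZ A B D :
  \sum_a xi1 cl (f *: x) a 0 A * torsion_of cl (f *: x) G a B D
  = f ^+ 3 * \sum_a xi1 cl x a 0 A * torsion_of cl x G a B D.
Proof.
rewrite mulr_sumr; apply: eq_bigr => a _.
by rewrite torsion_ofZ xi1Z mulrACA -exprS.
Qed.

Lemma Pi0_m32Z A B D :
  Pi0_m32 cl (f *: x) G A B D = f ^+ 3 * Pi0_m32 cl x G A B D.
Proof. exact: (skew3Z xi_torsionZ). Qed.

Lemma Pi1_m32Z A B D :
  Pi1_m32 cl (f *: x) G A B D = f ^+ 3 * Pi1_m32 cl x G A B D.
Proof. exact: (sym2Z (fun A' B' => xi_torsionZ A' B' D)). Qed.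

Lemma Pi0_m12Z A B : Pi0_m12 cl (f *: x) G A B = f ^+ 2 * Pi0_m12 cl x G A B.
Proof.
rewrite /Pi0_m12 (mulrBr (f ^+ 2)); congr (_ - _).
  by apply: mul_scaled; [exact: scalemxE | exact: trace_Gxi2Z].
apply: sum_scaled => b.
by apply: mul_scaled; [exact: xi1Z | exact: Gxi2_entryZ].
Qed.

Lemma Pi1_m12Z a B D :
  Pi1_m12 cl (f *: x) G a B D = f ^+ 2 * Pi1_m12 cl x G a B D.
Proof.
apply: comb_scaled; first exact: torsion_ofZ.
  apply: skew2Z => B' D'.
  by apply: mul_scaled; [exact: xi1Z | exact: trace_Gxi2Z].
apply: skew2Z => B' D'; apply: sum_scaled => b.
by apply: mul_scaled; [exact: xi1Z | exact: Gxi2_mulZ].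
Qed.

Section Dual.
Variable eps : 'M[C]_N.

Lemma Gxi2LZ b : Gxi2L cl (f *: x) G eps b = f *: Gxi2L cl x G eps b.
Proof.
rewrite /Gxi2L scaler_sumr; apply: eq_bigr => c _; rewrite scaler_sumr.
apply: eq_bigr => d _; rewrite /xi2L /lower -!scalemxAl !scalerA.
by congr (_ *: _); ring.
Qed.

Lemma Gxi2L_entryZ b A :
  Gxi2L cl (f *: x) G eps b 0 A = f * Gxi2L cl x G eps b 0 A.
Proof. by rewrite Gxi2LZ; exact: scalemxE. Qed.

Lemma Gxi2L_mulZ b (P : 'M[C]_N) D :
  (Gxi2L cl (f *: x) G eps b *m P) 0 D = f * (Gxi2L cl x G eps b *m P) 0 D.
Proof. by rewrite Gxi2LZ -scalemxAl; exact: scalemxE. Qed.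

Lemma trace_Gxi2LZ D : (\sum_b Gxi2L cl (f *: x) G eps b *m gamU cl eps b) 0 D
  = f * (\sum_b Gxi2L cl x G eps b *m gamU cl eps b) 0 D.
Proof.
rewrite [LHS]summxE [X in _ * X]summxE mulr_sumr.
by apply: eq_bigr => b _; exact: Gxi2L_mulZ.
Qed.

Lemma Pi1_m12_3Z a B D :
  Pi1_m12_3 cl (f *: x) G eps a B D = f ^+ 2 * Pi1_m12_3 cl x G eps a B D.
Proof.
apply: comb_scaled3; first exact: torsion_ofZ.
- apply: skew2Z => B' D'.
  by apply: mul_scaled; [exact: xi1Z | exact: trace_Gxi2LZ].
- apply: skew2Z => B' D'; apply: sum_scaled => b.
  by apply: mul_scaled; [exact: xi1Z | exact: Gxi2L_mulZ].
apply: sum_scaled => b; apply: sum_scaled => A.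
by apply: mul_scaled; [exact: xi1Z | exact: Gxi2L_entryZ].
Qed.

Hypothesis epsU : eps \in unitmx.

(** Each raised gamma carries an inverse of [eps] that cancels the preceding lowering, so the
    variant for m = 3 reuses the general trace terms. *)
Lemma Gxi2LE b : Gxi2L cl x G eps b = Gxi2 cl x G b *m eps.
Proof.
rewrite /Gxi2L /Gxi2 mulmx_suml; apply: eq_bigr => c _.
rewrite mulmx_suml; apply: eq_bigr => d _; rewrite -scalemxAl; congr (_ *: _).
rewrite /xi2L /xi2 /lower /gamU /gamL /gam2P -scalemxAr -scalemxAl.
have cancel (P Q : 'M[C]_N) :
    x *m eps *m (invmx eps *m P *m (Q *m eps)) = x *m (P *m Q) *m eps.
  by rewrite !mulmxA mulmxK.
by rewrite mulmxBr !cancel -mulmxBl -mulmxBr.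
Qed.

Lemma Gxi2L_gamU b a :
  Gxi2L cl x G eps b *m gamU cl eps a = Gxi2 cl x G b *m gamP cl a.
Proof. by rewrite Gxi2LE /gamU mulmxA mulmxK. Qed.

Lemma trace_Gxi2L : \sum_b Gxi2L cl x G eps b *m gamU cl eps b
  = \sum_b Gxi2 cl x G b *m gamP cl b.
Proof. by apply: eq_bigr => b _; exact: Gxi2L_gamU. Qed.

End Dual.
End Homogeneity.

(** * The differential conditions as multiples of the projections *)

Fact coef_m12 (K : fieldType) (m t s s' : K) : (4 : K) != 0 -> s' = - 4^-1 * s ->
  t + 2 / (m - 1) * s' = t - (2 * (m - 1))^-1 * s.
Proof.
move=> h4 ->; rewrite invfM; have <- : 2 * 4^-1 = 2^-1 :> K.
  have h2 : (2 : K) != 0.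
    by apply: contra_neq h4 => h; rewrite -[4]/(2 * 2)%:R natrM h mul0r.
  by field; rewrite h2.
by move: (m - 1)^-1 (4^-1) => i j; ring.
Qed.

Fact coef_m12_3 (K : fieldType) (t s s' v v' g : K) :
  (6 : K) != 0 -> s' = - 4^-1 * s -> v' = - 4^-1 * v ->
  t + s' - 2 / 3 * v' * g = t - 4^-1 * s + 6^-1 * v * g.
Proof.
move=> h6 -> ->; have h3 : (3 : K) != 0.
  by apply: contra_neq h6 => h; rewrite -[6]/(2 * 3)%:R natrM h mulr0.
have h2 : (2 : K) != 0.
  by apply: contra_neq h6 => h; rewrite -[6]/(2 * 3)%:R natrM h mul0r.
have h4 : (4 : K) != 0 by rewrite -[4]/(2 * 2)%:R natrM mulf_neq0.
by field; rewrite h6 h4.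
Qed.

Section Identities.
Variables (R : realType) (m : nat) (M : complex_manifold R (2 * m)).
Variables (g : holomorphic_metric M) (cl : clifford_rep R m).
Variables (S : spin_structure g cl).
Local Notation C := (Cx R).
Local Notation N := (2 ^ m.-1)%N.
Local Notation n := (2 * m)%N.
Variables (w : sidx S -> M -> 'I_n -> 'I_n -> 'I_n -> C) (k : sidx S).
Variables (xi : M -> 'rV[C]_N) (p : M) (G : 'I_n -> 'I_n -> 'I_n -> C).
Local Notation y a := (nablaSP w k a xi p).
Hypothesis dE : forall a b, nabla_xi1 w k xi p a b = xi1 cl (y a) b.
Hypothesis tor : intrinsic_torsion w k xi p G.

Lemma D_m32_inner A B D :
  \sum_a \sum_b xi1 cl (xi p) a 0 A * nabla_xi1 w k xi p a b 0 B
    * xi1 cl (xi p) b 0 D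
  = \sum_a xi1 cl (xi p) a 0 A * torsion_of cl (xi p) G a B D.
Proof.
apply: eq_bigr => a _; rewrite tor.2 mulr_sumr.
by apply: eq_bigr => b _; rewrite mulrA.
Qed.

Lemma D0_m32E A B D : D0_m32 w k xi p A B D = Pi0_m32 cl (xi p) G A B D.
Proof.
(* With factor 1, [skew3Z] acts as a congruence lemma under the bracket. *)
rewrite -[RHS]mul1r; apply: skew3Z => A' B' D'.
by rewrite mul1r; exact: D_m32_inner.
Qed.

Lemma D1_m32E A B D : D1_m32 w k xi p A B D = Pi1_m32 cl (xi p) G A B D.
Proof.
rewrite -[RHS]mul1r; apply: sym2Z => A' B'.
by rewrite mul1r; exact: D_m32_inner.
Qed.

Variable al : 'I_n -> C.
Hypothesis yE : forall a, y a = - 4^-1 *: Gxi2 cl (xi p) G a + al a *: xi p.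

Lemma nabla_mul a (P : 'M[C]_N) B : (y a *m P) 0 B
  = - 4^-1 * (Gxi2 cl (xi p) G a *m P) 0 B + al a * (xi p *m P) 0 B.
Proof.
rewrite yE mulmxDl -!scalemxAl [LHS]mxE.
by congr (_ + _); exact: scalemxE.
Qed.

Lemma nabla_entry a A : y a 0 A
  = - 4^-1 * Gxi2 cl (xi p) G a 0 A + al a * xi p 0 A.
Proof. by rewrite yE [LHS]mxE; congr (_ + _); exact: scalemxE. Qed.

(** The spinor alpha^b xi_b^B, through which alpha enters the divergence of xi^{bB}. *)
Definition al_xi B := \sum_b al b * xi1 cl (xi p) b 0 B.

Lemma div_xi B : \sum_b nabla_xi1 w k xi p b b 0 B
  = - 4^-1 * (\sum_b Gxi2 cl (xi p) G b *m gamP cl b) 0 B + al_xi B.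
Proof.
rewrite summxE mulr_sumr -big_split; apply: eq_bigr => b _ /=.
by rewrite dE; exact: nabla_mul.
Qed.

(** Both terms contribute xi^A alpha^b xi_b^B, with opposite signs. *)
Lemma D0_m12E A B : D0_m12 w k xi p A B = - 4^-1 * Pi0_m12 cl (xi p) G A B.
Proof.
have e : \sum_b xi1 cl (xi p) b 0 B * nablaSP w k b xi p 0 A
    = - 4^-1 * (\sum_b xi1 cl (xi p) b 0 B * Gxi2 cl (xi p) G b 0 A)
      + xi p 0 A * al_xi B.
  rewrite !mulr_sumr -big_split; apply: eq_bigr => b _ /=.
  rewrite (nabla_entry b A).
  by move: (Gxi2 _ _ _ _ _ _) (xi1 _ _ _ _ _) (al b) (xi p 0 A) => *; ring.
rewrite /D0_m12 e div_xi /Pi0_m12.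
move: (\sum_b (_ : C)) (fun_of_matrix _ 0 B) (al_xi B) (xi p 0 A) => *; ring.
Qed.

(** Together the two brackets contain alpha only in xi_a^B alpha^b xi_b^D + alpha^b xi_b^B xi_a^D.
    This is symmetric in B and D, so skewing removes it. *)
Lemma D1_skewE a B D : D1_skew w k xi p a B D
  = - 4^-1 * (skew2 (fun B' D' => xi1 cl (xi p) a 0 B'
      * (\sum_b Gxi2 cl (xi p) G b *m gamP cl b) 0 D') B D
    + skew2 (fun B' D' => \sum_b xi1 cl (xi p) b 0 B'
      * (Gxi2 cl (xi p) G b *m gamP cl a) 0 D') B D).
Proof.
pose F B' D' := xi1 cl (xi p) a 0 B'
  * (\sum_b Gxi2 cl (xi p) G b *m gamP cl b) 0 D'.
pose H B' D' := \sum_b xi1 cl (xi p) b 0 B'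
  * (Gxi2 cl (xi p) G b *m gamP cl a) 0 D'.
pose z B' := xi1 cl (xi p) a 0 B'.
have FE B' D' : z B' * (\sum_b nabla_xi1 w k xi p b b 0 D')
    = - 4^-1 * F B' D' + z B' * al_xi D'.
  rewrite div_xi /F -/(z B'); move: (fun_of_matrix _ 0 D') => *; ring.
have HE B' D' : \sum_b xi1 cl (xi p) b 0 B' * nabla_xi1 w k xi p b a 0 D'
    = - 4^-1 * H B' D' + al_xi B' * z D'.
  rewrite /al_xi mulr_suml mulr_sumr -big_split; apply: eq_bigr => b _ /=.
  rewrite dE (nabla_mul b (gamP cl a) D') -/(xi1 _ _ _) -/(z D').
  move: (fun_of_matrix (_ *m _) 0 D') (xi1 _ _ _ _ _) => *; ring.
have -> : D1_skew w k xi p a B D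
    = 2^-1 * ((- 4^-1 * F B D + z B * al_xi D)
              - (- 4^-1 * F D B + z D * al_xi B))
    + 2^-1 * ((- 4^-1 * H B D + al_xi B * z D)
              - (- 4^-1 * H D B + al_xi D * z B)).
  by rewrite -!FE -!HE.
rewrite /skew2 -/(F B D) -/(F D B) -/(H B D) -/(H D B).
move: (F B D) (F D B) (H B D) (H D B) (z B) (z D) (al_xi B) (al_xi D) => *.
by ring.
Qed.

Lemma D1_m12E a B D : D1_m12 w k xi p a B D = Pi1_m12 cl (xi p) G a B D.
Proof.
rewrite /D1_m12 /Pi1_m12 tor.2; apply: coef_m12; first by rewrite pnatr_eq0.
exact: D1_skewE.
Qed.

Variable eps : 'M[C]_N.
Hypothesis eps_dual : duality3 cl eps.

(** Lowering is parallel: [eps] intertwines the spin connection on S^+ with the dual one on S^-. *)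
Lemma nablaSMdual_lower b :
  differentiable (xi \o coordV (schart k)) (Defs.coord (schart k) p) ->
  nablaSMdual w k b (fun q => lower eps (xi q)) p = y b *m eps.
Proof.
move=> dxi; rewrite /nablaSMdual frame_der_mulmx //.
case: eps_dual => epsU _ skU skL.
have gam2E c d : eps *m (gam2M cl c d)^T = - (gam2P cl c d *m eps).
  rewrite /gam2M /gam2P linearZ /= -scalemxAr -scalemxAl -scalerN.
  congr (_ *: _); rewrite linearB /= mulmxBr mulmxBl opprB.
  (* Moving [eps] past a transposed product uses the skewness of both lowered and raised gammas. The
     two signs cancel and the order is reversed, so [gam2M] becomes minus [gam2P]. *)
  have flip i j :
      eps *m (gamM cl i *m gamP cl j)^T = gamP cl j *m gamM cl i *m eps.
    have -> : gamM cl i *m gamP cl j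
        = (gamM cl i *m eps) *m (invmx eps *m gamP cl j).
      by rewrite mulmxA mulmxK.
    rewrite trmx_mul skU skL mulNmx !mulmxN opprK !mulmxA mulmxV //.
    by rewrite mul1mx.
  by rewrite !flip.
rewrite mulmxBl; congr (_ + _).
rewrite -scalemxAl -scalerN; congr (_ *: _).
rewrite mulmx_suml -sumrN; apply: eq_bigr => c _.
rewrite mulmx_suml -sumrN; apply: eq_bigr => d _.
by rewrite -scalemxAl -scalerN -!mulmxA gam2E mulmxN.
Qed.

(** The sum is xi_B gamma_b^{BA} xi_A, a skew form evaluated twice on the same spinor. It eliminates
    alpha from the extra trace for m = 3. *)
Lemma lower_xi1_null b : \sum_A xi1 cl (xi p) b 0 A * (xi p *m eps) 0 A = 0.
Proof.
case: eps_dual => epsU _ skU _; set z := xi p *m eps.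
have -> : xi1 cl (xi p) b = z *m (invmx eps *m gamP cl b).
  by rewrite mulmxA mulmxK.
transitivity ((z *m (invmx eps *m gamP cl b) *m z^T) 0 0); last first.
  by rewrite (skew_form_null _ _ (skU b)) ?mxE // pnatr_eq0.
by rewrite [RHS]mxE; apply: eq_bigr => A _; rewrite [z^T _ _]mxE.
Qed.

Lemma D1_m12_3E a B D :
  differentiable (xi \o coordV (schart k)) (Defs.coord (schart k) p) ->
  D1_m12_3 w k xi p eps a B D = Pi1_m12_3 cl (xi p) G eps a B D.
Proof.
move=> dxi; case: (eps_dual) => epsU _ _ _.
rewrite /D1_m12_3 /Pi1_m12_3 tor.2; apply: coef_m12_3.
- by rewrite pnatr_eq0.
- rewrite D1_skewE -(trace_Gxi2L _ _ _ epsU).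
  congr (_ * (_ + skew2 _ B D)); apply/funext => B'; apply/funext => D'.
  by apply: eq_bigr => b _; rewrite Gxi2L_gamU.
rewrite mulr_sumr; apply: eq_bigr => b _.
rewrite nablaSMdual_lower // mulr_sumr.
transitivity (\sum_A
  (- 4^-1 * (xi1 cl (xi p) b 0 A * Gxi2L cl (xi p) G eps b 0 A)
   + al b * (xi1 cl (xi p) b 0 A * (xi p *m eps) 0 A))).
  apply: eq_bigr => A _; rewrite (nabla_mul b eps A) Gxi2LE //.
  move: (fun_of_matrix _ 0 A) (fun_of_matrix _ 0 A) (fun_of_matrix _ 0 A) => *.
  by ring.
rewrite big_split [X in _ + X = _](_ : _ = 0) ?addr0 //=.
by rewrite -mulr_sumr lower_xi1_null mulr0.
Qed.

End Identities.

(** * Existence of the torsion and change of representative *)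

Lemma mulmx_delta_form (K : comPzRingType) d (u v : 'rV[K]_d) i j :
  (u *m delta_mx i j *m v^T) 0 0 = u 0 i * v 0 j.
Proof.
rewrite -(mul_delta_mx (0 : 'I_1)) mulmxA -colE -mulmxA -rowE.
by rewrite mxE big_ord1 !mxE.
Qed.

(** As a bilinear form this is a Pluecker coordinate of u /\ v; the vanishing of all of them
    expresses proportionality polynomially. *)
Definition wedge_mx (K : pzRingType) d (i j : 'I_d) : 'M[K]_d :=
  delta_mx i j - delta_mx j i.

Lemma mulmx_wedge (K : comPzRingType) d (u v : 'rV[K]_d) i j :
  (u *m wedge_mx K i j *m v^T) 0 0 = u 0 i * v 0 j - u 0 j * v 0 i.
Proof.
by rewrite mulmxBr mulmxBl [LHS]mxE [X in _ + X]mxE !mulmx_delta_form.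
Qed.

Lemma wedge_parallel (K : comPzRingType) d (u : 'rV[K]_d) c i j :
  c *: u *m wedge_mx K i j *m u^T = 0.
Proof.
apply/matrixP => r s; rewrite !ord1 mulmx_wedge !mxE.
by rewrite mulrAC subrr.
Qed.

Lemma wedge_proportional (K : fieldType) d (x dx dx' : 'rV[K]_d) f : x != 0 ->
  (forall i j, dx' *m wedge_mx K i j *m x^T
               + f *: x *m wedge_mx K i j *m dx^T = 0) ->
  exists c, dx' = f *: dx + c *: x.
Proof.
move=> x0 h; have [|c hc] := @proportional K d x (dx' - f *: dx) x0.
  move=> i j; have /matrixP/(_ 0 0) := h i j.
  rewrite [LHS]mxE !mulmx_wedge !mxE => e.
  by apply/eqP; rewrite -subr_eq0 -e; apply/eqP; ring.
by exists c; rewrite -hc addrC subrK.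
Qed.

Lemma gram_rescaled (K : comPzRingType) n d (X Y : 'M[K]_(n, d)) f c B D :
  X^T *m X = 0 ->
  ((f *: Y + c *: X)^T *m (f *: X)) B D = f ^+ 2 * (Y^T *m X) B D.
Proof.
move=> X0; rewrite -scalemxAr linearP /= linearZ /= mulmxDl -!scalemxAl X0.
by rewrite scaler0 addr0 scalerA -expr2 mxE.
Qed.

Section Representatives.
Variables (R : realType) (m : nat) (M : complex_manifold R (2 * m)).
Variables (g : holomorphic_metric M) (cl : clifford_rep R m).
Variables (S : spin_structure g cl).
Local Notation C := (Cx R).
Local Notation N := (2 ^ m.-1)%N.
Local Notation n := (2 * m)%N.
Variables (w : sidx S -> M -> 'I_n -> 'I_n -> 'I_n -> C).
Hypothesis hw : levi_civita w.
Variables (L : sidx S -> M -> set 'rV[C]_N) (k : sidx S).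
Implicit Types (U : set M) (xi : M -> 'rV[C]_N) (p : M).
Implicit Types (G : 'I_n -> 'I_n -> 'I_n -> C).

Lemma represents_nabla_xi1 U xi p : represents L k U xi -> U p ->
  forall a b, nabla_xi1 w k xi p a b = xi1 cl (nablaSP w k a xi p) b.
Proof.
by move=> [_ Uk hol _ _] pU a b; apply: nabla_xi1E => //; [exact: Uk|exact: hol].
Qed.

(** For each direction, the skew Gram matrix of the derivative with xi factors through a skew matrix
    by [skew_factor]. *)
Lemma intrinsic_torsion_exists U xi p : represents L k U xi -> U p ->
  exists G, intrinsic_torsion w k xi p G.
Proof.
move=> hxi pU; have dE := represents_nabla_xi1 hxi pU.
have [oU Uk hol pure _] := hxi.
have h a := skew_factor (nablaSP_gram_skew hw a oU Uk hol pure pU).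
pose H a := projT1 (cid (h a)).
have HP a := projT2 (cid (h a)).
exists (fun a b c => H a b c); split.
  move=> a b c; have [Hs _] := HP a; rewrite -/(H a) in Hs.
  by have /matrixP/(_ c b) := Hs; rewrite [LHS]mxE [RHS]mxE.
move=> a B D; have [_ Ht] := HP a; rewrite -/(H a) in Ht.
rewrite torsion_ofE; have -> : conn_mx (fun b c => H a b c) = H a.
  by apply/matrixP => b c; rewrite mxE.
by rewrite Ht gram_xi1_mx; apply: eq_bigr => b _; rewrite dE.
Qed.

Lemma torsion_conditions U xi p G : (0 < m)%N -> represents L k U xi -> U p ->
  intrinsic_torsion w k xi p G ->
  [/\ vanish3 (Pi0_m32 cl (xi p) G) <-> vanish3 (D0_m32 w k xi p),
      vanish3 (Pi1_m32 cl (xi p) G) <-> vanish3 (D1_m32 w k xi p),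
      vanish2 (Pi0_m12 cl (xi p) G) <-> vanish2 (D0_m12 w k xi p),
      vanish3 (Pi1_m12 cl (xi p) G) <-> vanish3 (D1_m12 w k xi p) &
      forall eps, duality3 cl eps ->
        (vanish3 (Pi1_m12_3 cl (xi p) G eps) <->
         vanish3 (D1_m12_3 w k xi p eps))].
Proof.
move=> m0 hxi pU tor; have dE := represents_nabla_xi1 hxi pU.
have [oU Uk hol pure _] := hxi.
have [||||al yE] := @torsion_spinor _ _ cl (xi p) G (fun a => nablaSP w k a xi p).
- exact: m0.
- exact: pure.
- exact: tor.1.
- move=> a; apply/matrixP => B D; rewrite -torsion_ofE tor.2 gram_xi1_mx.
  by apply: eq_bigr => b _; rewrite dE.
have n1 : (1 : C) != 0 by exact: oner_neq0.
split.
- by apply: (vanish3_scale n1) => A B D; rewrite mul1r; exact: D0_m32E.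
- by apply: (vanish3_scale n1) => A B D; rewrite mul1r; exact: D1_m32E.
- apply: (@vanish2_scale _ _ _ _ _ (- 4^-1)).
    by rewrite oppr_eq0 invr_eq0 pnatr_eq0.
  by move=> A B; exact: D0_m12E.
- apply: (vanish3_scale n1) => A B D; rewrite mul1r.
  exact: (D1_m12E dE tor yE).
move=> eps he; apply: (vanish3_scale n1) => A B D; rewrite mul1r.
by apply: (D1_m12_3E dE tor yE he); exact: hol.
Qed.

(** Only the ratio at [p] and one unspecified multiple of xi per direction are retained, the latter
    standing for the derivative of the scale. *)
Lemma rescaled U U' xi xi' p : represents L k U xi -> represents L k U' xi' ->
  U p -> U' p ->
  exists f, [/\ f != 0, xi' p = f *: xi p &
    forall a, exists be,
      nablaSP w k a xi' p = f *: nablaSP w k a xi p + be *: xi p].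
Proof.
move=> [oU Uk hol pure LE] [oU' U'k hol' pure' LE'] pU pU'.
have prop q : U q -> U' q -> exists c, xi' q = c *: xi q.
  move=> qU qU'; have : L k q (xi' q).
    by rewrite LE' //; exists 1; rewrite ?scale1r.
  by rewrite LE // => -[c _ <-]; exists c.
have [f fE] := prop p pU pU'; exists f.
have [xp0 _] := pure p pU; have [xp'0 _] := pure' p pU'.
have f0 : f != 0 by apply: contra_neq xp'0 => f0; rewrite fE f0 scale0r.
split=> // a; set d := frame_der k a xi p; set d' := frame_der k a xi' p.
(* Differentiating the proportionality of xi' and xi in the division-free     *)
(* form xi'_i xi_j = xi'_j xi_i avoids differentiating their ratio.           *)
have [|be beE] := @wedge_proportional _ _ (xi p) d d' f xp0.
  move=> i j; rewrite -fE.
  have := @derive_bilinear0 _ _ _ _ _ (wedge_mx C i j) _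
    (row a (frame k p)) (hol' p pU') (hol p pU).
  rewrite -/(frame_der k a xi p) -/(frame_der k a xi' p) -/d -/d' /=.
  rewrite coordK; last exact: sdom_chart (Uk _ pU).
  apply; have nU := near_coordV oU Uk pU.
  have nU' := near_coordV oU' U'k pU'.
  apply: filterS2 nU nU' => q qU qU'; have [c ->] := prop _ qU qU'.
  exact: wedge_parallel.
exists be; rewrite /nablaSP -/d -/d' beE fE scalerBr addrAC; congr (_ - _ + _).
rewrite scalerA mulrC -scalerA; congr (_ *: _).
rewrite scaler_sumr; apply: eq_bigr => b _.
rewrite scaler_sumr; apply: eq_bigr => c _.
by rewrite -scalemxAl !scalerA mulrC.
Qed.

(** Both sides of the torsion equation acquire the factor [f ^+ 2]; the extra multiple of xi is
    invisible to the Gram matrix by nullity. *)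
Lemma rescaled_torsion U U' xi xi' p f G :
  represents L k U xi -> represents L k U' xi' -> U p -> U' p ->
  f != 0 -> xi' p = f *: xi p ->
  (forall a, exists be,
     nablaSP w k a xi' p = f *: nablaSP w k a xi p + be *: xi p) ->
  intrinsic_torsion w k xi p G <-> intrinsic_torsion w k xi' p G.
Proof.
move=> hxi hxi' pU pU' f0 fE yE.
have dE := represents_nabla_xi1 hxi pU.
have dE' := represents_nabla_xi1 hxi' pU'.
have [_ _ _ pure _] := hxi.
have gram a B D :
    \sum_b nabla_xi1 w k xi' p a b 0 B * xi1 cl (xi' p) b 0 D
    = f ^+ 2 * \sum_b nabla_xi1 w k xi p a b 0 B * xi1 cl (xi p) b 0 D.
  have [be ye] := yE a.
  under eq_bigr => b _ do rewrite dE'.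
  under [in RHS]eq_bigr => b _ do rewrite dE.
  rewrite -!gram_xi1_mx fE ye.
  have -> : xi1_mx cl (f *: xi p) = f *: xi1_mx cl (xi p) by exact: linearZ.
  have -> : xi1_mx cl (f *: nablaSP w k a xi p + be *: xi p)
      = f *: xi1_mx cl (nablaSP w k a xi p) + be *: xi1_mx cl (xi p).
    by rewrite linearP; congr (_ + _); exact: linearZ.
  by apply: gram_rescaled; exact: pure_spinor_null (pure p pU).
split=> -[Gs tor]; split=> // a B D; first by rewrite gram fE torsion_ofZ tor.
apply: (mulfI (expf_neq0 2 f0)).
by rewrite -gram -tor fE torsion_ofZ.
Qed.

End Representatives.

Lemma iff_via (A B A' B' : Prop) : (A <-> B) -> (A' <-> B') -> (A <-> A') ->
  (B <-> B').
Proof. by move=> h1 h2 h3; rewrite -h1 -h2. Qed.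

Theorem proposition5p4 (R : realType) (m : nat) (hm : (2 < m)%N)
    (M : complex_manifold R (2 * m)) (g : holomorphic_metric M)
    (cl : clifford_rep R m) (S : spin_structure g cl)
    (w : sidx S -> M -> 'I_(2 * m) -> 'I_(2 * m) -> 'I_(2 * m) -> Cx R)
    (hw : levi_civita w)
    (L : sidx S -> M -> set 'rV[Cx R]_(2 ^ m.-1))
    (hL : projective_pure_spinor_field L)
    (k : sidx S) (U : set M) (xi : M -> 'rV[Cx R]_(2 ^ m.-1))
    (hxi : represents L k U xi) (p : M) (hp : U p) :
  (exists G, intrinsic_torsion w k xi p G) /\
  (forall G, intrinsic_torsion w k xi p G ->
    [/\ vanish3 (Pi0_m32 cl (xi p) G) <-> vanish3 (D0_m32 w k xi p),
        vanish3 (Pi1_m32 cl (xi p) G) <-> vanish3 (D1_m32 w k xi p),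
        vanish2 (Pi0_m12 cl (xi p) G) <-> vanish2 (D0_m12 w k xi p),
        (3 < m)%N ->
          (vanish3 (Pi1_m12 cl (xi p) G) <->
           vanish3 (D1_m12 w k xi p)) &
        m = 3%N -> forall eps, duality3 cl eps ->
          (vanish3 (Pi1_m12_3 cl (xi p) G eps) <->
           vanish3 (D1_m12_3 w k xi p eps))]) /\
  (* independence of the scaling: xi' is any other representative near p *)
  (forall (U' : set M) (xi' : M -> 'rV[Cx R]_(2 ^ m.-1)),
    represents L k U' xi' -> U' p ->
    (forall G, intrinsic_torsion w k xi p G <-> intrinsic_torsion w k xi' p G) /\
    (forall G, intrinsic_torsion w k xi p G ->
      [/\ vanish3 (Pi0_m32 cl (xi p) G) <->
            vanish3 (Pi0_m32 cl (xi' p) G),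
          vanish3 (Pi1_m32 cl (xi p) G) <->
            vanish3 (Pi1_m32 cl (xi' p) G),
          vanish2 (Pi0_m12 cl (xi p) G) <->
            vanish2 (Pi0_m12 cl (xi' p) G),
          (3 < m)%N ->
            (vanish3 (Pi1_m12 cl (xi p) G) <->
             vanish3 (Pi1_m12 cl (xi' p) G)) &
          m = 3%N -> forall eps, duality3 cl eps ->
            (vanish3 (Pi1_m12_3 cl (xi p) G eps) <->
             vanish3 (Pi1_m12_3 cl (xi' p) G eps))]) /\
    [/\ vanish3 (D0_m32 w k xi p) <-> vanish3 (D0_m32 w k xi' p),
        vanish3 (D1_m32 w k xi p) <-> vanish3 (D1_m32 w k xi' p),
        vanish2 (D0_m12 w k xi p) <-> vanish2 (D0_m12 w k xi' p),
        (3 < m)%N ->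
          (vanish3 (D1_m12 w k xi p) <-> vanish3 (D1_m12 w k xi' p)) &
        m = 3%N -> forall eps, duality3 cl eps ->
          (vanish3 (D1_m12_3 w k xi p eps) <->
           vanish3 (D1_m12_3 w k xi' p eps))]).
Proof.
have m0 : (0 < m)%N by exact: leq_trans hm.
split; first exact: (intrinsic_torsion_exists hw hxi hp).
split.
  move=> G tor; have [h1 h2 h3 h4 h5] := torsion_conditions hw m0 hxi hp tor.
  by split=> // _; exact: h5.
move=> U' xi' hxi' hp'; have [f [f0 fE yE]] := rescaled w hxi hxi' hp hp'.
have torE G := rescaled_torsion hw G hxi hxi' hp hp' f0 fE yE.
have f2 : f ^+ 2 != 0 by exact: expf_neq0.
have f3 : f ^+ 3 != 0 by exact: expf_neq0.
have PiE G :
  [/\ vanish3 (Pi0_m32 cl (xi p) G) <-> vanish3 (Pi0_m32 cl (xi' p) G),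
      vanish3 (Pi1_m32 cl (xi p) G) <-> vanish3 (Pi1_m32 cl (xi' p) G),
      vanish2 (Pi0_m12 cl (xi p) G) <-> vanish2 (Pi0_m12 cl (xi' p) G),
      vanish3 (Pi1_m12 cl (xi p) G) <-> vanish3 (Pi1_m12 cl (xi' p) G) &
      forall eps, vanish3 (Pi1_m12_3 cl (xi p) G eps) <->
                  vanish3 (Pi1_m12_3 cl (xi' p) G eps)].
  rewrite fE; split.
  - by apply: (vanish3_scale f3); exact: Pi0_m32Z.
  - by apply: (vanish3_scale f3); exact: Pi1_m32Z.
  - by apply: (vanish2_scale f2); exact: Pi0_m12Z.
  - by apply: (vanish3_scale f2); exact: Pi1_m12Z.
  - by move=> eps; apply: (vanish3_scale f2); exact: Pi1_m12_3Z.
split; first exact: torE.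
split=> [G _|]; first by have [h1 h2 h3 h4 h5] := PiE G; split.
(* One [G] is a torsion for both representatives, so invariance of the differential conditions is
   inherited from the homogeneous projections. *)
have [G tor] := intrinsic_torsion_exists hw hxi hp.
have [h1 h2 h3 h4 h5] := torsion_conditions hw m0 hxi hp tor.
have [h1' h2' h3' h4' h5'] :=
  torsion_conditions hw m0 hxi' hp' ((torE G).1 tor).
have [e1 e2 e3 e4 e5] := PiE G.
split; [exact: iff_via h1 h1' e1 | exact: iff_via h2 h2' e2 |
  exact: iff_via h3 h3' e3 | |].
  by move=> _; exact: iff_via h4 h4' e4.
by move=> _ eps he; exact: iff_via (h5 eps he) (h5' eps he) (e5 eps).
Qed.
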